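(* Let $d\ge3$ and $j\in\{1,\ldots,d-2\}$. There exists a function $D:\mathbb{S}^{d-1}\to\mathbb{R}$ such that for every $k\in\mathbb{Z}_+$, every $\alpha\in\tau_k^{d-1}\setminus{}_j\tau_k^{d-1}$ and every $\xi\in\mathbb{S}^{d-1}$ ($D$ being independent of $\alpha$), $$|Y_\alpha(\xi)|\le D(\xi)\sqrt{N_{|\alpha_j|,j+1}}\ \prod_{\ell=j+1}^{d-1}(2\alpha_\ell+\ell-1)^{1/4}.$$
   Context: $\mathbb{Z}_+=\{0,1,2,\ldots\}$, and $\mathbb{S}^{d-1}$ is the unit sphere in $\mathbb{R}^d$. Index sets: $\tau_k^{d-1}:=\{\alpha=(\alpha_1,\ldots,\alpha_{d-1})\in\mathbb{Z}^{d-1}:|\alpha_1|\le\alpha_2\le\cdots\le\alpha_{d-1}=k\}$ and ${}_j\tau_k^{d-1}:=\{\alpha\in\tau_k^{d-1}:\alpha_j=0\}$. $N_{k,n}$ is the dimension of the space of spherical harmonics of degree $k$ on $\mathbb{S}^{n-1}$: $N_{0,n}=1$ and $N_{k,n}=\frac{(2k+n-2)(k+n-3)!}{k!(n-2)!}$ for $k\ge1$, $n\ge 2$. Polar coordinates $(\theta_1,\ldots,\theta_{d-1})$ of $\xi\in\mathbb{S}^{d-1}$: $\xi_1=\cos\theta_{d-1}$, $\xi_2=\sin\theta_{d-1}\cos\theta_{d-2}$, ..., $\xi_{d-1}=\sin\theta_{d-1}\cdots\sin\theta_2\cos\theta_1$, $\xi_d=\sin\theta_{d-1}\cdots\sin\theta_2\sin\theta_1$,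 with $\theta_1\in[0,2\pi)$ and $\theta_i\in[0,\pi]$ for $i\ge2$. Spherical harmonics: for $\alpha\in\tau_k^{d-1}$, $$Y_\alpha(\xi)=\frac{1}{\sqrt{2\pi}}e^{i\alpha_1\theta_1}\prod_{i=2}^{d-1}{}_{i}\tilde{\mathsf P}_{\alpha_i}^{\alpha_{i-1}}(\theta_i),$$ $${}_{i}\tilde{\mathsf P}_{L}^{\ell}(\theta)=\left(\frac{\pi\,\Gamma(i/2)}{\Gamma((i+1)/2)}\right)^{1/2}{}_{i}c_L^{\ell}\,(\sin\theta)^{-(i-2)/2}\,\mathsf P_{L+(i-2)/2}^{-(\ell+(i-2)/2)}(\cos\theta),\qquad {}_{i}c_L^{\ell}=\left(\frac{2L+i-1}{2}\,\frac{(L+\ell+i-2)!}{(L-\ell)!}\right)^{1/2},$$ extended continuously to $\theta\in\{0,\pi\}$. Here $\mathsf P_\nu^\mu$ is the associated Legendre (Ferrers) function on $(-1,1)$, $\mathsf P_\nu^\mu(x)=\left(\frac{1+x}{1-x}\right)^{\mu/2}\mathbf{F}\left(\nu+1,-\nu;1-\mu;\frac{1-x}{2}\right)$, with $\mathbf F(a,b;c;z)=\sum_{n\ge0}\frac{(a)_n(b)_n}{\Gamma(c+n)\,n!}z^n$. *)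

(* Defs.v *)
From HB Require Import structures.
From mathcomp Require Import all_boot all_order all_algebra.
From mathcomp Require Import all_classical all_reals all_analysis.
From mathcomp Require Import complex ring lra zify.

Set Implicit Arguments.
Unset Strict Implicit.
Unset Printing Implicit Defensive.

Import Order.TTheory GRing.Theory Num.Theory.
Import numFieldNormedType.Exports.

Local Open Scope classical_set_scope.
Local Open Scope ring_scope.

(* Multi-indices in Z^(d-1) and angles in R^(d-1) are tuples; coordinates are
   numbered from 1, so v 1, ..., v n are the entries of an n-tuple (the index 0
   is never used). *)
Definition crd (V : nmodType) (n : nat) (v : n.-tuple V) (i : nat) : V :=
  v`_i.-1.

(* for d >= 3, as the chain of inequalities starts with |alpha_1| <= alpha_2 *)
Definition tau (d k : nat) : set (d.-1.-tuple int) :=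
  [set alpha | [/\ `|crd alpha 1| <= crd alpha 2,
     forall i, (2 <= i < d.-1)%N -> crd alpha i <= crd alpha i.+1
     & crd alpha d.-1 = k%:Z]].
Arguments tau : clear implicits.

Definition tau0 (d j k : nat) : set (d.-1.-tuple int) :=
  [set alpha | tau d k alpha /\ crd alpha j = 0].
Arguments tau0 : clear implicits.

Definition harm_dim (R : realType) (k n : nat) : R :=
  if k is 0%N then 1
  else ((2 * k + n - 2) * (k + n - 3)`!)%N%:R / (k`! * (n - 2)`!)%N%:R.
Arguments harm_dim : clear implicits.

Definition unit_sphere (R : realType) (d : nat) : set 'rV[R]_d :=
  [set xi | \sum_(m < d) xi 0 m ^+ 2 = 1].
Arguments unit_sphere : clear implicits.

(* The entry of index m (counted from 0) is
   sin theta_(d-1) * ... * sin theta_(d-m) * cos theta_(d-1-m),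
   without the cosine for the last entry m = d-1. *)
Definition from_polar (R : realType) (d : nat) (theta : d.-1.-tuple R) :
    'rV[R]_d :=
  \row_(m < d) ((\prod_(d - m <= i < d) sin (crd theta i)) *
    (if (m.+1 < d)%N then cos (crd theta (d - m.+1)%N) else 1)).

Definition polar_coords (R : realType) (d : nat) (xi : 'rV[R]_d) :
    set (d.-1.-tuple R) :=
  [set theta | [/\ 0 <= crd theta 1 < 2 * pi,
     forall i, (2 <= i < d)%N -> 0 <= crd theta i <= pi
     & xi = from_polar theta]].

(* Some polar coordinates of xi; they exist on the sphere by [polar_coords_ex].
   They are unique unless sin theta_i = 0 for some i >= 2, and then the choice
   does not affect the value of [Yharm] below. *)
Definition angles (R : realType) (d : nat) (xi : 'rV[R]_d) : d.-1.-tuple R :=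
  xget [tuple of nseq d.-1 0] (polar_coords xi).

(* Gauss's product. At the poles 0, -1, -2, ... the denominator eventually
   vanishes, so that Gamma x = 0 and (Gamma x)^-1 = 0, which is the right value
   of the entire function 1/Gamma there. *)
Definition Gamma (R : realType) (x : R) : R :=
  limn (fun n : nat =>
    n`!%:R * n%:R `^ x / \prod_(0 <= m < n.+1) (x + m%:R)).

Definition poch (R : realType) (a : R) (n : nat) : R :=
  \prod_(0 <= m < n) (a + m%:R).

(* Olver's regularised hypergeometric function *)
Definition hypF (R : realType) (a b c z : R) : R :=
  limn (series (fun n : nat =>
    poch a n * poch b n / (Gamma (c + n%:R) * n`!%:R) * z ^+ n)).

Definition ferrersP (R : realType) (nu mu x : R) : R :=
  ((1 + x) / (1 - x)) `^ (mu / 2) * hypF (nu + 1) (- nu) (1 - mu) ((1 - x) / 2).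

(* The absolute values turn integers that are nonnegative in all uses into
   natural numbers. *)
Definition Pconst (R : realType) (i : nat) (L l : int) : R :=
  Num.sqrt ((2 * L%:~R + i%:R - 1) / 2 *
    ((absz (L + l + i%:Z - 2)%R)`!%:R / (absz (L - l)%R)`!%:R)).

(* the function on the open interval 0 < t < pi *)
Definition Ptilde_in (R : realType) (i : nat) (L l : int) (t : R) : R :=
  Num.sqrt (pi * Gamma (i%:R / 2) / Gamma ((i%:R + 1) / 2)) * Pconst R i L l *
  sin t `^ (- ((i%:R - 2) / 2)) *
  ferrersP (L%:~R + (i%:R - 2) / 2) (- (l%:~R + (i%:R - 2) / 2)) (cos t).

Definition Ptilde (R : realType) (i : nat) (L l : int) (t : R) : R :=
  if t == 0 then lim (Ptilde_in i L l s @[s --> 0^'+])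
  else if t == pi then lim (Ptilde_in i L l s @[s --> pi^'-])
  else Ptilde_in i L l t.

Definition expi (R : realType) (t : R) : R[i] := Complex (cos t) (sin t).

Definition Yharm (R : realType) (d : nat) (alpha : d.-1.-tuple int)
    (xi : 'rV[R]_d) : R[i] :=
  let theta := angles xi in
  ((Num.sqrt (2 * pi))^-1)%:C%C *
  expi ((crd alpha 1)%:~R * crd theta 1) *
  \prod_(2 <= i < d)
    (Ptilde i (crd alpha i) (crd alpha i.-1) (crd theta i))%:C%C.

Lemma polar_coords2 (R : realType) (r a b : R) :
  0 <= r -> a ^+ 2 + b ^+ 2 = r ^+ 2 ->
  exists t : R, [/\ 0 <= t < 2 * pi, a = r * cos t & b = r * sin t].
Proof.
move=> r0 hx; have pi0 := pi_gt0 R.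
have [r_eq0|rN0] := eqVneq r 0.
  exists 0; rewrite lexx r_eq0 !mul0r mulr_gt0//.
  have h := sqr_ge0 a; have h' := sqr_ge0 b.
  rewrite r_eq0 expr0n/= in hx.
  by split=> //; apply/eqP; rewrite -sqrf_eq0; apply/eqP; lra.
have rp : 0 < r by rewrite lt_def rN0.
have h01 : -1 <= a / r <= 1.
  rewrite ler_pdivlMr// ler_pdivrMr// mulN1r mul1r -ler_norml.
  by rewrite -(ger0_norm r0) -ler_sqr ?nnegrE// !real_normK ?num_real// -hx lerDl sqr_ge0.
pose t := acos (a / r).
have ct : cos t = a / r by rewrite acosK// in_itv.
have t0 : 0 <= t by rewrite acos_ge0.
have tpi : t <= pi by rewrite acos_lepi.
have st0 : 0 <= sin t by rewrite sin_ge0_pi// t0.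
have hst : (r * sin t) ^+ 2 = b ^+ 2.
  rewrite exprMn sin2cos2 ct.
  have -> : r ^+ 2 * (1 - (a / r) ^+ 2) = r ^+ 2 - a ^+ 2 by field.
  by rewrite -hx; ring.
have rs0 : 0 <= r * sin t by rewrite mulr_ge0.
have [b0|b0] := leP 0 b.
  exists t; split; first by rewrite t0/=; lra.
    by rewrite ct; field.
  by apply/eqP; rewrite eq_sym -(eqrXn2 (n := 2))//; apply/eqP.
have tN0 : t != 0.
  apply/negP => /eqP t0'; move: hst; rewrite t0' sin0 mulr0 expr0n/=.
  by move/esym/eqP; rewrite sqrf_eq0 => /eqP bE; rewrite bE ltxx in b0.
exists (2 * pi - t).
have -> : 2 * pi - t = - t + pi *+ 2 by rewrite mulr2n; ring.
rewrite cosD2pi sinD2pi cosN sinN ct; split; last 2 first.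
- by field.
- have e : r * sin t = - b.
    by apply/eqP; rewrite -(eqrXn2 (n := 2))// ?oppr_ge0 ?ltW// sqrrN; apply/eqP.
  by rewrite mulrN e opprK.
- have t_gt0 : 0 < t by rewrite lt_def tN0.
  by rewrite mulr2n; apply/andP; split; lra.
Qed.

Lemma polar_coords_rec (R : realType) (n : nat) (r : R) (x : nat -> R) :
  0 <= r -> \sum_(0 <= m < n.+2) x m ^+ 2 = r ^+ 2 ->
  exists theta : nat -> R,
    [/\ 0 <= theta 1%N < 2 * pi,
      forall i, (2 <= i < n.+2)%N -> 0 <= theta i <= pi &
      forall m, (m < n.+2)%N ->
        x m = r * ((\prod_(n.+2 - m <= i < n.+2) sin (theta i)) *
          (if (m.+1 < n.+2)%N then cos (theta (n.+2 - m.+1)%N) else 1))].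
Proof.
elim: n r x => [|n IH] r x r0.
  rewrite big_nat_recr//= big_nat1 => /(polar_coords2 r0)[t [ht h0 h1]].
  exists (fun=> t); split => // [i|[|[|m]]//]; first lia.
    by rewrite subn0 big_geq// mul1r.
  by rewrite subSS subn0 big_nat1 mulr1.
rewrite big_nat_recl// => hx.
pose s := Num.sqrt (\sum_(0 <= i < n.+2) x i.+1 ^+ 2).
have S0 : 0 <= \sum_(0 <= i < n.+2) x i.+1 ^+ 2.
  by apply: sumr_ge0 => i _; exact: sqr_ge0.
have s0 : 0 <= s by exact: sqrtr_ge0.
have s2 : s ^+ 2 = \sum_(0 <= i < n.+2) x i.+1 ^+ 2 by rewrite sqr_sqrtr.
have [t [ht h0 h1]] : exists t : R,
    [/\ 0 <= t <= pi, x 0%N = r * cos t & s = r * sin t].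
  have [t [/andP[t0 t2] h0 h1]] : exists t : R,
      [/\ 0 <= t < 2 * pi, x 0%N = r * cos t & s = r * sin t].
    by apply: polar_coords2; rewrite // s2.
  have [tpi|tpi] := leP t pi; first by exists t; rewrite t0.
  have st : sin t <= 0.
    rewrite -oppr_ge0; have -> : t = (t - pi) + pi by ring.
    by rewrite sinDpi opprK sin_ge0_pi//; apply/andP; split; lra.
  have s00 : r * sin t = 0.
    by apply/eqP; rewrite eq_le -{2}h1 s0 andbT mulr_ge0_le0.
  have pi0 := pi_ge0 R.
  have /orP[/eqP rE|/eqP sE] : (r == 0) || (sin t == 0).
    by rewrite -mulf_eq0 s00.
    exists 0; rewrite lexx pi0 h0 h1 rE !mul0r.
    by split.
  exists (t - pi); exfalso.
  have : 0 < sin (t - pi) by apply: sin_gt0_pi; apply/andP; split; lra.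
  have : sin t = - sin (t - pi) by rewrite -sinDpi; congr sin; ring.
  by rewrite sE => /eqP; rewrite eq_sym oppr_eq0 => /eqP ->; rewrite ltxx.
have [th [a b c]] := IH s (fun m => x m.+1) s0 (esym s2).
exists (fun i => if i == n.+2 then t else th i); split=> //.
- move=> i hi; case: eqVneq => [//|iN]; apply: b; lia.
- case=> [|m] hm; first by rewrite subn0 big_geq// subSS subn0 eqxx mul1r.
  rewrite c ?subSS// h1 [in RHS]big_nat_recr/=; last lia.
  rewrite eqxx -[(m.+2 < n.+3)%N]/(m.+1 < n.+2)%N [(n.+1 - m)%N == _](_ : _ = false); last first.
    by apply/negP => /eqP; lia.
  rewrite (_ : \prod_(n.+2 - m <= i < n.+2) sin (if i == n.+2 then t else th i)
      = \prod_(n.+2 - m <= i < n.+2) sin (th i)).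
    by ring.
  by apply: eq_big_nat => i hi; case: eqVneq => // ?; lia.
Qed.

Lemma polar_coords_ex (R : realType) (d : nat) (xi : 'rV[R]_d) :
  (2 <= d)%N -> unit_sphere R d xi -> polar_coords xi !=set0.
Proof.
case: d xi => [|[|n]]// xi _ xi1.
pose x m := if insub m is Some i then xi 0 (i : 'I_n.+2) else 0.
have xE (i : 'I_n.+2) : x i = xi 0 i by rewrite /x valK.
have [|th [a b c]] := @polar_coords_rec R n 1 x ler01.
  by rewrite expr1n big_mkord -xi1; apply: eq_bigr => i _; rewrite xE.
have tE i : (0 < i < n.+2)%N -> crd (mktuple (fun i : 'I_n.+1 => th i.+1)) i = th i.
  move=> hi; have hi' : (i.-1 < n.+1)%N by lia.
  rewrite /crd -[i.-1]/(nat_of_ord (Ordinal hi')) -tnth_nth tnth_mktuple/=.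
  by congr th; lia.
exists (mktuple (fun i : 'I_n.+1 => th i.+1)); split.
- by rewrite tE.
- by move=> i hi; rewrite tE; [exact: b | lia].
- apply/rowP => m; rewrite mxE -xE c// mul1r; congr (_ * _).
    by apply: eq_big_nat => i hi; rewrite tE//; have := ltn_ord m; lia.
  by case: ifP => // hm; rewrite tE//; lia.
Qed.

(* Main.v *)
Require Import Defs.
From mathcomp Require Import all_boot all_order all_algebra.
From mathcomp Require Import all_classical all_reals all_analysis.
From mathcomp Require Import complex ring lra zify.
Import Order.TTheory GRing.Theory Num.Theory.
Import numFieldNormedType.Exports.
Local Open Scope classical_set_scope.
Local Open Scope ring_scope.

(* Put N = 2l + i - 1, n = L - l and mu = n + N/2.  The hypergeometric function
   in the polar factor of index i sums to a Gegenbauer polynomial q_n of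
   parameter N/2, so that, up to a constant depending on i only, the factor is
   u / sin^((i-1)/2) with u = K sin^(N/2) q_n(cos t) and
     u'' + q u = 0,  q = mu^2 - B / sin^2,  B = N(N-2)/4.
   The main point is u(t)^2 <= C(t) sqrt mu, uniformly in n and N.  Where q is
   large, sqrt q u^2 + u'^2 / sqrt q is almost invariant, and at the equator it
   is O(mu) by the explicit values of q_n and q_n' at 0; near the turning point
   of q, u is reached from the right by a short interval on which u'^2 + q u^2,
   which increases towards the equator, is under control.
   At the poles a factor with l <> 0 vanishes, and one with l = 0 has square
   O((L+1)^(i-1)).  As D may depend on xi in any way, the indices i <= j then
   contribute at most a constant times (|alpha_j|+1)^((j-1)/2), which
   sqrt N_(|alpha_j|,j+1) dominates, and the indices i > j contribute a power
   1/4 each, because alpha_j <> 0 excludes the second case at the poles. *)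

(** The obstacle is uniformity in l. N grows with l, so B can be of the order of mu^2, and the
    turning point of q moves with alpha: for a fixed angle it may lie on either side of it and
    arbitrarily close to it. The power mu^(1/2) is what n = 0 forces: then q equals mu at the
    equator and u is a multiple of sin^(N/2), which concentrates there; the hypothesis
    [mu <= mu ^+ 2 - B] is an equality in this case. The passage to Gegenbauer polynomials rests on
    a recurrence rather than on transformations of hypergeometric series. For a fixed order the
    series satisfy the three-term relation in the degree, already term by term, and this is the
    recurrence of q_n; so only the lowest degree has to be summed, where one finds a binomial series
    for l >= 0 and a single power of z for l < 0. As Gamma is a limit, its functional equation is
    established at the positive half-integers, the only positive arguments that occur. *)

(** * Derivatives of pointwise expressions and monotonicity *)

Section derive_pointwise.
Local Set Implicit Arguments.
Local Unset Strict Implicit.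
Variable R : realType.
Implicit Types (f g : R -> R) (x a b c : R).

Lemma is_derive_pt_eq f x a b :
  is_derive x 1 f a -> a = b -> is_derive x 1 f b.
Proof. by move=> + <-. Qed.

Lemma is_derive_ptD f g x a b :
  is_derive x 1 f a -> is_derive x 1 g b ->
  is_derive x 1 (fun t => f t + g t) (a + b).
Proof. exact: is_deriveD. Qed.

Lemma is_derive_ptN f x a :
  is_derive x 1 f a -> is_derive x 1 (fun t => - f t) (- a).
Proof. exact: is_deriveN. Qed.

Lemma is_derive_ptM f g x a b :
  is_derive x 1 f a -> is_derive x 1 g b ->
  is_derive x 1 (fun t => f t * g t) (a * g x + f x * b).
Proof.
move=> df dg; apply: (@is_derive_eq _ _ _ _ _ _ _ _ (is_deriveM df dg)).
by rewrite /GRing.scale/= addrC mulrC.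
Qed.

Lemma is_derive_ptX f n x a :
  is_derive x 1 f a ->
  is_derive x 1 (fun t => f t ^+ n) (n%:R * f x ^+ n.-1 * a).
Proof.
move=> df; have -> : (fun t => f t ^+ n) = f ^+ n by apply/funext => t; rewrite fctE.
by apply: (@is_derive_eq _ _ _ _ _ _ _ _ (is_deriveX n df)).
Qed.

Lemma is_derive_ptV f x a : f x != 0 ->
  is_derive x 1 f a -> is_derive x 1 (fun t => (f t)^-1) (- a / f x ^+ 2).
Proof.
move=> fx0 df; apply: (@is_derive_eq _ _ _ _ _ _ _ _ (is_deriveV fx0 df)).
by rewrite /GRing.scale/=; field.
Qed.

(** Only continuity is asked at the endpoints: [P] is treated this way on an interval that starts at
    0, where [q] is singular. *)
Lemma nondecreasing_of_derive f f' a b : a <= b ->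
  (forall t, a < t < b -> is_derive t 1 f (f' t)) ->
  {within `[a, b], continuous f} ->
  (forall t, a < t < b -> 0 <= f' t) -> f a <= f b.
Proof.
rewrite le_eqVlt => /predU1P[->//|ab] df cf f'0.
have df' x : x \in `]a, b[ -> is_derive x 1 f (f' x) by rewrite in_itv => /df.
have [c] := MVT ab df' cf; rewrite in_itv/= => cab e; rewrite -subr_ge0 e mulr_ge0 ?f'0// subr_ge0 ltW//.
Qed.

Lemma nondecreasing_of_derive_cc f f' a b : a <= b ->
  (forall t, a <= t <= b -> is_derive t 1 f (f' t)) ->
  (forall t, a < t < b -> 0 <= f' t) -> f a <= f b.
Proof.
move=> ab df f'0; apply: (@nondecreasing_of_derive f f') => //.
  by move=> t /andP[h1 h2]; apply: df; rewrite !ltW.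
apply: derivable_within_continuous => t; rewrite in_itv => /df ?.
exact: ex_derive.
Qed.

End derive_pointwise.

(** * Uniform bound for u'' + (mu^2 - B / sin^2) u = 0 *)

Section oscillator.
Local Set Implicit Arguments.
Local Unset Strict Implicit.
Variable R : realType.
(* U, P and V stand for u^2, u u' and u'^2, where u'' + q u = 0; they are
   polynomial in sin and cos, which u need not be. *)
Variables (B mu A : R) (U P V : R -> R).
Let q (t : R) : R := mu ^+ 2 - B / sin t ^+ 2.
(** The normalisation differs from the polar factors by mu: [U] is built on [geg_weight] alone, so
    that [A] is a constant and the bound aimed at is of order 1 / sqrt mu. *)
Hypotheses (B0 : 0 <= B) (mu1 : 1 <= mu) (muB : mu <= mu ^+ 2 - B).
Hypothesis dU : forall t : R, 0 < t < pi -> is_derive t 1 U (2 * P t).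
Hypothesis dP : forall t : R, 0 < t < pi -> is_derive t 1 P (V t - q t * U t).
Hypothesis dV : forall t : R, 0 < t < pi -> is_derive t 1 V (- (2 * q t * P t)).
Hypotheses (U0 : forall t : R, 0 < t < pi -> 0 <= U t)
  (V0 : forall t : R, 0 < t < pi -> 0 <= V t)
  (PUV : forall t : R, 0 < t < pi -> P t ^+ 2 = U t * V t).
Hypotheses (P00 : P 0 = 0) (cP : continuous P).
Hypothesis GA : V (pi / 2) + (mu ^+ 2 - B) * U (pi / 2) <=
  A * Num.sqrt (mu ^+ 2 - B).

Let pi0 : 0 < pi :> R := pi_gt0 R.

Let sin0 (t : R) : 0 < t < pi -> 0 < sin t.
Proof. exact: sin_gt0_pi. Qed.

Let W (t : R) : R := mu ^+ 2 * sin t ^+ 2 - B.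
Let w (t : R) : R := Num.sqrt (W t).

Let dW (t : R) : is_derive t 1 W (2 * mu ^+ 2 * sin t * cos t).
Proof.
apply: (@is_derive_eq _ _ _ _ _ _ _ _ (is_derive_ptD
   (is_derive_ptM (is_derive_cst (mu ^+ 2) t 1)
     (is_derive_ptX 2 (is_derive_sin t))) (is_derive_cst (- B) t 1))).
by rewrite /=; ring.
Qed.

Let qW (t : R) : 0 < t < pi -> q t = W t / sin t ^+ 2.
Proof. by move=> /sin0 s0; rewrite /q /W; field; rewrite gt_eqF. Qed.

Let dw (t : R) : 0 < W t -> is_derive t 1 w (mu ^+ 2 * sin t * cos t / w t).
Proof.
move=> W0; apply: (@is_derive_eq _ _ _ _ _ _ _ _
  (is_derive1_comp (is_derive1_sqrt W0) (dW t))).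
by rewrite /w; field; rewrite gt_eqF// sqrtr_gt0.
Qed.

(** The weight a is sqrt q when the invariant is compared with P, and half of sqrt (q a) near the
    turning point. *)
Let AMGM (t a : R) : 0 < t < pi -> 0 < a -> 2 * `|P t| <= a * U t + V t / a.
Proof.
move=> ht a0; have u0 := U0 ht; have v0 := V0 ht.
have s0 : 0 <= a * U t + V t / a by rewrite addr_ge0// ?divr_ge0// ?mulr_ge0// ltW.
rewrite -ler_sqr ?nnegrE ?mulr_ge0// exprMn real_normK ?num_real//.
rewrite PUV// -subr_ge0.
have -> : (a * U t + V t / a) ^+ 2 - 2 ^+ 2 * (U t * V t) = (a * U t - V t / a) ^+ 2.
  by field; rewrite gt_eqF.
exact: sqr_ge0.
Qed.

Let G (t : R) : R := V t + q t * U t.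

Let dq (t : R) : 0 < t < pi -> is_derive t 1 q (2 * B * cos t / sin t ^+ 3).
Proof.
move=> ht; have s0 := sin0 ht.
have s0' : sin t ^+ 2 != 0 by rewrite expf_neq0// gt_eqF.
rewrite (_ : q = fun t => mu ^+ 2 + - B * (sin t ^+ 2)^-1); last first.
  by apply/funext => z; rewrite /q mulNr.
apply: (@is_derive_eq _ _ _ _ _ _ _ _ (is_derive_ptD
   (is_derive_cst (mu ^+ 2) t 1) (is_derive_ptM (is_derive_cst (- B) t 1)
    (is_derive_ptV (f := fun t => sin t ^+ 2) s0' (is_derive_ptX 2 (is_derive_sin t)))))).
by rewrite /=; field; rewrite gt_eqF.
Qed.

Let dG (t : R) : 0 < t < pi -> is_derive t 1 G (2 * B * cos t / sin t ^+ 3 * U t).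
Proof.
move=> ht; have s0 := sin0 ht.
apply: (@is_derive_eq _ _ _ _ _ _ _ _ (is_derive_ptD (dV ht)
  (is_derive_ptM (dq ht) (dU ht)))).
by ring.
Qed.

Let cos0 (t : R) : 0 <= t <= pi / 2 -> 0 <= cos t.
Proof. by move=> /andP[a b]; apply: cos_ge0_pihalf; apply/andP; split; lra. Qed.

Let G_nd (a b : R) : 0 < a -> a <= b -> b <= pi / 2 -> G a <= G b.
Proof.
move=> a0 ab bpi.
apply: (@nondecreasing_of_derive_cc _ _ (fun t => 2 * B * cos t / sin t ^+ 3 * U t) _ _ ab) => t /andP[h1 h2].
  by apply: dG; apply/andP; split; lra.
have ht : 0 < t < pi by apply/andP; split; lra.
have c0 : 0 <= cos t by apply: cos0; apply/andP; split; lra.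
have s0 := sin0 ht.
apply: mulr_ge0; last exact: U0.
apply: divr_ge0; last by rewrite exprn_ge0// ltW.
by apply: mulr_ge0 => //; apply: mulr_ge0.
Qed.

Let mB0 : 0 < mu ^+ 2 - B. Proof. by apply: lt_le_trans muB; apply: lt_le_trans mu1. Qed.

Let sqB0 : 0 < Num.sqrt (mu ^+ 2 - B). Proof. by rewrite sqrtr_gt0. Qed.

Let pih : 0 < (pi : R) / 2 < pi.
Proof. by have := pi0; move=> ?; apply/andP; split; lra. Qed.

Let A0 : 0 <= A.
Proof.
have := le_trans _ GA; move=> /(_ 0); rewrite pmulr_lge0//; apply.
by rewrite addr_ge0 ?V0// mulr_ge0 ?U0// ltW.
Qed.

Let G_le (t : R) : 0 < t <= pi / 2 -> G t <= A * Num.sqrt (mu ^+ 2 - B).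
Proof.
move=> /andP[t0 tp]; apply: le_trans (G_nd t0 tp (lexx _)) _.
by rewrite /G /q sin_pihalf expr1n divr1.
Qed.

(* The first factor is the adiabatic invariant of u with the first-order
   correction that removes u'^2 and u^2 from its derivative; the second one
   compensates for the remaining term, as long as B cos t / w^3 <= 1/2. *)
Let K (t : R) : R := (w t / sin t * U t + sin t / w t * V t + B * cos t / w t ^+ 3 * P t) *
  (1 - B * cos t / w t ^+ 3).

(** With kappa = B cos t / w^3 = q' / (2 q^(3/2)), the leading factor is kappa'. The derivative of
    (w / sin) U + (sin / w) V is kappa (q U - V) and that of kappa P is kappa' P + kappa (V - q U),
    so the first factor of [K] has derivative kappa' P. *)
Let K' (t : R) : R := - (B * sin t / w t ^+ 3 + 3 * B * cos t ^+ 2 * mu ^+ 2 * sin t / w t ^+ 5) *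
 ((1 - 2 * (B * cos t / w t ^+ 3)) * P t - (w t / sin t * U t + sin t / w t * V t)).

Let dK (t : R) : 0 < t < pi -> 0 < W t -> is_derive t 1 K (K' t).
Proof.
move=> ht W0.
have w0 : 0 < w t by rewrite sqrtr_gt0.
have s0 := sin0 ht.
have s0' : sin t != 0 by rewrite gt_eqF.
have w0' : w t != 0 by rewrite gt_eqF.
have w3' : w t ^+ 3 != 0 by rewrite expf_neq0.
have ds := is_derive_sin t; have dc := is_derive_cos t; have dw' := dw W0.
have dk := is_derive_ptM (is_derive_ptM (is_derive_cst B t 1) dc)
  (is_derive_ptV (f := fun t => w t ^+ 3) w3' (is_derive_ptX 3 dw')).
have dd := (is_derive_ptM
  (is_derive_ptD (is_derive_ptD
    (is_derive_ptM (is_derive_ptM dw' (is_derive_ptV (f := @sin R) s0' ds)) (dU ht))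
    (is_derive_ptM (is_derive_ptM ds (is_derive_ptV (f := w) w0' dw')) (dV ht)))
    (is_derive_ptM dk (dP ht)))
  (is_derive_ptD (is_derive_cst (1 : R) t 1) (is_derive_ptN dk))).
apply: (is_derive_pt_eq (f := K) dd).
rewrite /K' qW// /=.
have w2 : W t = w t ^+ 2 by rewrite sqr_sqrtr// ltW.
(* Once B is eliminated, the identity is rational in independent quantities. *)
have -> : B = mu ^+ 2 * sin t ^+ 2 - w t ^+ 2 by rewrite -w2 /W; ring.
rewrite w2; field.
by rewrite s0' w0'.
Qed.


Let lt0pi (t : R) : 0 < t -> t <= pi / 2 -> 0 < t < pi.
Proof. by have := pi0; move=> ? ? ?; apply/andP; split; lra. Qed.

Let sin_le (a b : R) : 0 < a -> a <= b -> b <= pi / 2 -> sin a <= sin b.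
Proof.
move=> a0; rewrite le_eqVlt => /predU1P[->//|ab] bp; apply/ltW.
by have := pi0; move=> ?; rewrite ltr_sin// in_itv/=; apply/andP; split; lra.
Qed.

Let cos_le (a b : R) : 0 < a -> a <= b -> b <= pi / 2 -> cos b <= cos a.
Proof.
move=> a0; rewrite le_eqVlt => /predU1P[->//|ab] bp; apply/ltW.
by have := pi0; move=> ?; rewrite ltr_cos// in_itv/=; apply/andP; split; lra.
Qed.

Let W_le (a b : R) : 0 < a -> a <= b -> b <= pi / 2 -> W a <= W b.
Proof.
move=> a0 ab bp.
have sa : 0 < sin a by apply: sin0; apply: lt0pi => //; lra.
have sb : 0 < sin b by apply: sin0; apply: lt0pi => //; lra.
rewrite /W lerD2r ler_wpM2l ?sqr_ge0// lerXn2r ?nnegrE ?(ltW sa) ?(ltW sb)//.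
exact: sin_le.
Qed.

(** The uncorrected invariant sqrt q u^2 + u'^2 / sqrt q, since sqrt q = w / sin. *)
Let H (t : R) : R := w t / sin t * U t + sin t / w t * V t.

Let PH (t : R) : 0 < t < pi -> 0 < W t -> 2 * `|P t| <= H t.
Proof.
move=> ht W0; have s0 := sin0 ht.
have w0 : 0 < w t by rewrite sqrtr_gt0.
have := AMGM ht (divr_gt0 w0 s0).
by rewrite [X in _ <= _ + X]mulrC invf_div.
Qed.

(** The last hypothesis says kappa <= 1/2 at a, hence on all of [a, pi/2]. There kappa' <= 0 and 2
    |P| <= H make [K] nondecreasing; at the equator kappa = 0 and K = H <= A, while at a one has K
    >= (H - H/4) / 2. *)
Let HA (a : R) : 0 < a <= pi / 2 -> 0 < W a -> 2 * B * cos a <= w a ^+ 3 ->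
  H a <= 8 / 3 * A.
Proof.
move=> /andP[a0 ap] Wa ka.
have w0 t : a <= t -> t <= pi / 2 -> 0 < w t.
  by move=> h1 h2; rewrite sqrtr_gt0 (lt_le_trans Wa)// W_le.
have kt t : a <= t -> t <= pi / 2 -> 0 <= B * cos t / w t ^+ 3 <= 2^-1.
  move=> h1 h2; have wt := w0 _ h1 h2.
  have c0 : 0 <= cos t by apply: cos0; apply/andP; split; lra.
  have w3 : 0 < w t ^+ 3 by rewrite exprn_gt0.
  apply/andP; split; first by rewrite divr_ge0 ?mulr_ge0// ltW.
  rewrite ler_pdivrMr//.
  have h3 : w a ^+ 3 <= w t ^+ 3.
    by rewrite lerXn2r ?nnegrE ?sqrtr_ge0// ler_wsqrtr// W_le.
  have h4 : B * cos t <= B * cos a by rewrite ler_wpM2l// cos_le.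
  lra.
have Kle : K a <= K (pi / 2).
  apply: (@nondecreasing_of_derive_cc _ K K') => // t /andP[h1 h2].
    apply: dK; first by apply: lt0pi => //; lra.
    by rewrite (lt_le_trans Wa)// W_le.
  have ht : 0 < t < pi by apply: lt0pi; lra.
  have h1' := ltW h1; have h2' := ltW h2.
  have wt := w0 _ h1' h2'; have s0 := sin0 ht.
  have Wt : 0 < W t by rewrite (lt_le_trans Wa)// W_le.
  have /andP[k1 k2] := kt _ h1' h2'.
  have c2 : 0 <= cos t ^+ 2 by rewrite sqr_ge0.
  rewrite /K' mulNr -mulrN; apply: mulr_ge0.
    have w3 n : 0 <= w t ^+ n by rewrite exprn_ge0// ltW.
    have s0' := ltW s0.
    have m2 : 0 <= mu ^+ 2 by rewrite sqr_ge0.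
    apply: addr_ge0; apply: divr_ge0 => //; first exact: mulr_ge0.
    by do 4 (apply: mulr_ge0 => //).
  have := PH ht Wt; rewrite -/(H t) oppr_ge0 subr_le0 => hP.
  have hP1 := ler_norm (P t); have hP0 := normr_ge0 (P t).
  set k := B * cos t / _ in k1 k2 *.
  apply: (@le_trans _ _ ((1 - 2 * k) * `|P t|)).
    by rewrite ler_wpM2l//; lra.
  apply: (@le_trans _ _ (1 * `|P t|)); last lra.
  by rewrite ler_wpM2r//; lra.
have Kpi : K (pi / 2) <= A.
  have wp : w (pi / 2) = Num.sqrt (mu ^+ 2 - B).
    by rewrite /w /W sin_pihalf expr1n mulr1.
  rewrite /K cos_pihalf sin_pihalf mulr0 !mul0r addr0 subr0 mulr1 divr1.
  rewrite wp -(ler_pM2r sqB0) (le_trans _ GA)// le_eqVlt; apply/orP; left; apply/eqP.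
  rewrite -[in RHS](sqr_sqrtr (ltW mB0)).
  by field; rewrite gt_eqF.
have ha : 0 < a < pi by apply: lt0pi.
have /andP[k1 k2] := kt a (lexx _) ap.
have hP := PH ha Wa.
have hP1 := ler_norm (- P a); rewrite normrN in hP1.
have hP0 := normr_ge0 (P a).
have H0 : 0 <= H a by lra.
have : K a >= 3 / 8 * H a.
  rewrite /K -/(H a); set k := B * cos a / _ in k1 k2 *.
  have h5 : - (1 / 4 * H a) <= k * P a.
    have : k * - P a <= 2^-1 * `|P a|.
      by apply: (@le_trans _ _ (k * `|P a|)); rewrite ?ler_wpM2l ?ler_wpM2r.
    lra.
  have h6 : 3 / 4 * H a <= H a + k * P a by lra.
  apply: (@le_trans _ _ (3 / 4 * H a * (1 - k))).
    have -> : 3 / 8 * H a = 3 / 4 * H a * (1 - 2^-1) by field.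
    by rewrite ler_wpM2l//; lra.
  by rewrite ler_wpM2r//; lra.
lra.
Qed.

(* a is where the invariant stops being reliable; th lies to its left, at a
   distance at most 1 / sqrt (q a) since q is concave there. *)
Let q_nonneg_bound (th a : R) : 0 < th -> th <= a -> a <= pi / 2 -> 0 <= W th -> 0 < W a ->
  w a ^+ 3 = 2 * B * cos a -> U th <= 27 * A * (sin a / w a).
Proof.
move=> th0 tha ap Wth Wa ka; have a0 : 0 < a by apply: lt_le_trans tha.
have ha : 0 < a < pi by apply: lt0pi.
have w0 : 0 < w a by rewrite sqrtr_gt0.
have s0 := sin0 ha.
have hH : H a <= 8 / 3 * A by apply: HA; rewrite ?ka// a0.
pose r := w a / sin a; have r0 : 0 < r by rewrite divr_gt0.
have -> : sin a / w a = r^-1 by rewrite invf_div.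
have qa : q a = r ^+ 2 by rewrite qW// /r expr_div_n sqr_sqrtr// ltW.
have HE : H a = r * U a + V a / r by rewrite /H /r invf_div; congr (_ + _); rewrite mulrC.
have GE : G a = r * H a by rewrite /G qa HE; field; rewrite gt_eqF.
have ht t : th <= t -> t <= a -> 0 < t < pi by move=> h1 h2; apply: lt0pi; lra.
have q0 t : th <= t -> t <= a -> 0 <= q t.
  move=> h1 h2; have hh := ht _ h1 h2; have st := sin0 hh.
  by rewrite qW// divr_ge0 ?sqr_ge0// (le_trans Wth)// W_le//; lra.
have hr : (a - th) * r <= 1.
  move: tha; rewrite le_eqVlt => /predU1P[->|tha]; first by rewrite subrr mul0r.
  have dq' x : x \in `]th, a[ -> is_derive x 1 q (2 * B * cos x / sin x ^+ 3).
    by rewrite in_itv/= => /andP[h1 h2]; apply: dq; apply: ht; apply: ltW.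
  have cq : {within `[th, a], continuous q}.
    apply: derivable_within_continuous => t; rewrite in_itv/= => /andP[h1 h2].
    by have [] := dq (ht t h1 h2).
  have [c] := MVT tha dq' cq; rewrite in_itv/= => /andP[h1 h2].
  have hc : 0 < c < pi by apply: ht; apply: ltW.
  have sc := sin0 hc.
  (* By [ka] the right-hand side, which is q', equals r^3 at a, and it decreases towards a. *)
  have cc : r ^+ 3 <= 2 * B * cos c / sin c ^+ 3.
    rewrite /r expr_div_n ka.
    apply: ler_pM; rewrite ?invr_ge0 ?exprn_ge0 ?mulr_ge0//.
    - by apply: cos0; apply/andP; split; lra.
    - exact: ltW.
    - by rewrite ler_wpM2l ?mulr_ge0// cos_le//; lra.
    - have sca : sin c <= sin a by apply: sin_le => //; lra.
      rewrite lef_pV2 ?posrE ?exprn_gt0// lerXn2r ?nnegrE//; exact: ltW.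
  have := q0 th (lexx _) (ltW tha); rewrite qa => qth e.
  have h7 : r ^+ 3 * (a - th) <= r ^+ 2.
    apply: (@le_trans _ _ (r ^+ 2 - q th)); last lra.
    by rewrite e ler_wpM2r//; lra.
  have r2 : 0 < r ^+ 2 by rewrite exprn_gt0.
  rewrite -(ler_pM2r r2) mul1r; apply: le_trans h7.
  by rewrite le_eqVlt; apply/orP; left; apply/eqP; ring.
(* c is chosen so that F' >= 0: with k = r (t - th) in [0, 1], 2 (1 + k) |P| <= r U + 4 V / r, and V
   <= G a turns the last term into at most c r. *)
pose c := 4 * G a / r ^+ 2.
have G0 : 0 <= G a by rewrite addr_ge0 ?mulr_ge0 ?V0 ?U0// q0.
have c0 : 0 <= c by rewrite divr_ge0 ?sqr_ge0//; apply: mulr_ge0.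
pose F t := (U t + c) * (1 + r * (t - th)).
pose F' t := 2 * P t * (1 + r * (t - th)) + (U t + c) * r.
have FF : F th <= F a.
  apply: (@nondecreasing_of_derive_cc _ F F') => // t /andP[h1 h2].
    have dd := is_derive_ptM (is_derive_ptD (dU (ht t h1 h2)) (is_derive_cst c t 1))
      (is_derive_ptD (is_derive_cst (1 : R) t 1) (is_derive_ptM (is_derive_cst r t 1)
         (is_derive_ptD (is_derive_id t 1) (is_derive_cst (- th) t 1)))).
    by apply: (@is_derive_eq _ _ _ _ _ _ _ _ dd); rewrite /F'/=; ring.
  have h1' := ltW h1; have h2' := ltW h2.
  have hh := ht _ h1' h2'.
  have r20 : 0 < r / 2 by rewrite divr_gt0.
  have := AMGM hh r20.
  have -> : V t / (r / 2) = 2 * V t / r by field; rewrite gt_eqF.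
  move=> hP; have v0 := V0 hh; have u0 := U0 hh.
  have VG : V t <= G a.
    apply: (@le_trans _ _ (G t)); last by apply: G_nd => //; lra.
    by rewrite lerDl mulr_ge0// q0.
  have hV : 4 * V t / r <= c * r.
    have -> : c * r = 4 * G a / r by rewrite /c; field; rewrite gt_eqF.
    by rewrite ler_pM2r ?invr_gt0// ler_pM2l.
  have hk : 0 <= r * (t - th) <= 1.
    apply/andP; split; first by rewrite mulr_ge0 ?subr_ge0// ltW.
    by apply: le_trans hr; rewrite mulrC ler_wpM2r ?(ltW r0)//; lra.
  set k := r * (t - th) in hk *.
  have hP0 := normr_ge0 (P t).
  have hP1 := ler_norm (- P t); rewrite normrN in hP1.
  have h8 : (1 + k) * - P t <= 2 * `|P t|.
    apply: (@le_trans _ _ ((1 + k) * `|P t|)); first by rewrite ler_wpM2l//; lra.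
    by rewrite ler_wpM2r//; lra.
  have hV2 : 2 * V t / r = 4 * V t / r / 2 by field; rewrite gt_eqF.
  rewrite /F' -/k; move: hP hV h8; rewrite hV2; move: (4 * V t / r) (`|P t|) => z1 z2.
  clearbody c k => hP hV h8. lra.
(* The constant: F a <= 2 (U a + c) <= 10 H a / r <= (80/3) A / r, and 80/3 < 27. *)
have : U th <= F a.
  apply: le_trans FF; rewrite /F subrr mulr0 addr0 mulr1; lra.
have U0a := U0 ha; have V0a := V0 ha.
have Fa : F a <= (U a + c) * 2.
  by rewrite /F ler_wpM2l ?addr_ge0//; move: hr; rewrite mulrC; lra.
have cE : c = 4 * (H a / r) by rewrite /c GE; field; rewrite gt_eqF.
have Ua : U a <= H a / r.
  rewrite ler_pdivlMr// HE mulrC lerDl divr_ge0// ltW//.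
have HAr : H a / r <= 8 / 3 * A / r by rewrite ler_pM2r// invr_gt0.
have Ar : 0 <= A / r by rewrite divr_ge0// ltW.
move: Fa HAr; rewrite cE -!mulrA; lra.
Qed.

(** Left of the turning point q <= 0, so P' = V - q U >= 0; as P vanishes at 0, P >= 0 and U
    increases up to the zero b of W. *)
Let q_neg_mono (th a : R) : 0 < th -> th <= a -> a <= pi / 2 -> W th < 0 -> 0 < W a ->
  exists b, [/\ th <= b, b <= a, W b = 0 & U th <= U b].
Proof.
move=> th0 tha ap Wth Wa.
have cW : {within `[th, a], continuous W}.
  by apply: derivable_within_continuous => t _; apply: ex_derive.
have [|b] := @IVT R W th a 0 tha cW.
  by rewrite ge_min le_max (ltW Wth) (ltW Wa) orbT.
rewrite in_itv/= => /andP[thb ba] Wb; exists b; split => //.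
have ht t : 0 < t -> t <= b -> 0 < t < pi by move=> h1 h2; apply: lt0pi; lra.
have Ppos t : 0 < t -> t <= b -> 0 <= P t.
  move=> t0 tb; rewrite -P00.
  apply: (@nondecreasing_of_derive _ P (fun t => V t - q t * U t)) => //.
  - exact: ltW.
  - by move=> x /andP[h1 h2]; apply: dP; apply: ht => //; lra.
  - by apply: continuous_subspaceT.
  - move=> x /andP[h1 h2]; have hx : 0 < x < pi by apply: ht => //; lra.
    have qx : q x <= 0.
      rewrite qW// pmulr_lle0 ?invr_gt0 ?exprn_gt0 ?sin0// -Wb W_le//; lra.
    by rewrite subr_ge0 (le_trans _ (V0 hx))// mulr_le0_ge0// U0.
apply: (@nondecreasing_of_derive_cc _ U (fun t => 2 * P t)) => // t /andP[h1 h2].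
  by apply: dU; apply: ht => //; lra.
by rewrite mulr_ge0// Ppos//; lra.
Qed.

(** Put r^2 = q a and X = B cot^2 a; then mu^2 - B = r^2 + X, and the bound on the correction gives
    4 B X <= r^6. If r^2 < e mu, then X <= e mu / 4, whence mu^2 - B < (5/4) e mu <= (5/8) mu,
    against [muB]. *)
Let q_lower (a e : R) : 0 < a -> a <= pi / 2 -> 0 < W a -> 2 * B * cos a <= w a ^+ 3 ->
  0 < e <= 2^-1 -> e * mu ^+ 2 <= B -> e * mu <= (w a / sin a) ^+ 2.
Proof.
move=> a0 ap Wa ka /andP[e0 e1] eB.
have ha := lt0pi a0 ap; have s0 := sin0 ha.
have w0 : 0 < w a by rewrite sqrtr_gt0.
have mu0 : 0 < mu by apply: lt_le_trans mu1.
have c0 : 0 <= cos a by apply: cos0; rewrite (ltW a0).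
rewrite leNgt; apply/negP => hr.
set r := w a / sin a in hr *.
have r0 : 0 < r by rewrite divr_gt0.
pose X := B * (cos a / sin a) ^+ 2.
have X0 : 0 <= X by rewrite mulr_ge0 ?sqr_ge0.
have hX : mu ^+ 2 - B = r ^+ 2 + X.
  rewrite /r /X !expr_div_n sqr_sqrtr ?ltW// /W cos2sin2; field.
  by rewrite gt_eqF.
have h1 : 2 * B * (cos a / sin a) <= r ^+ 3.
  apply: (@le_trans _ _ (2 * B * cos a / sin a ^+ 3)).
    rewrite mulrA; apply: ler_wpM2l.
      by apply: mulr_ge0 => //; apply: mulr_ge0.
    rewrite lef_pV2 ?posrE ?exprn_gt0// exprS -[leRHS]mulr1 (ler_pM2l s0).
    by rewrite exprn_ile1 ?sin_le1// ltW.
  by rewrite /r expr_div_n ler_pM2r// invr_gt0 exprn_gt0.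
have h2 : 4 * B * X <= (r ^+ 2) ^+ 3.
  have -> : 4 * B * X = (2 * B * (cos a / sin a)) ^+ 2 by rewrite /X; ring.
  have cs0 : 0 <= cos a / sin a by rewrite divr_ge0// ltW.
  rewrite exprAC lerXn2r ?nnegrE ?exprn_ge0 ?(ltW r0)//.
  by apply: mulr_ge0 => //; apply: mulr_ge0.
have h3 : (r ^+ 2) ^+ 3 <= (e * mu) ^+ 3.
  by rewrite lerXn2r ?nnegrE ?sqr_ge0 ?mulr_ge0 ?ltW.
have h4 : 4 * (e * mu ^+ 2) * X <= (e * mu) ^+ 3.
  apply: le_trans h3; apply: le_trans h2; apply: ler_wpM2r => //.
  exact: ler_wpM2l.
have h5 : 4 * X <= e ^+ 2 * mu.
  have em : 0 < e * mu ^+ 2 by rewrite mulr_gt0 ?exprn_gt0.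
  rewrite -(ler_pM2l em).
  have -> : e * mu ^+ 2 * (4 * X) = 4 * (e * mu ^+ 2) * X by ring.
  by have -> : e * mu ^+ 2 * (e ^+ 2 * mu) = (e * mu) ^+ 3 by ring.
have h6 : e ^+ 2 * mu <= e * mu.
  apply: ler_wpM2r; first exact: ltW.
  rewrite expr2 -[leRHS]mulr1 (ler_pM2l e0); lra.
have h7 : e * mu <= 2^-1 * mu by apply: ler_wpM2r => //; exact: ltW.
have muB' := muB; rewrite hX in muB'.
clearbody X r; move: hr h5 h6 h7 muB' mu0.
move: (r ^+ 2) (e ^+ 2 * mu) (e * mu) => x1 x2 x3; lra.
Qed.

Lemma oscillator_bound (th : R) : 0 < th <= pi / 2 ->
  U th <= 40 * A / (sin th * Num.sqrt mu).
Proof.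
move=> /andP[th0 thp].
have hth := lt0pi th0 thp; have s0 := sin0 hth.
have mu0 : 0 < mu by apply: lt_le_trans mu1.
have sm0 : 0 < Num.sqrt mu by rewrite sqrtr_gt0.
have sm1 : 1 <= Num.sqrt mu by rewrite -sqrtr1 ler_wsqrtr.
have smE : mu = Num.sqrt mu ^+ 2 by rewrite sqr_sqrtr// ltW.
have s1 := sin_le1 th.
pose e := sin th ^+ 2 / 2.
have s20 : 0 < sin th ^+ 2 by rewrite exprn_gt0.
have s21 : sin th ^+ 2 <= 1 by rewrite exprn_ile1// ltW.
have e0 : 0 < e by rewrite divr_gt0.
(* If B is small against (mu sin th)^2, q is at least mu^2 / 2 at th and the monotonicity of G
   suffices; otherwise B is large enough for [q_lower]. *)
have [Be|eB] := ltP B (e * mu ^+ 2).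
  have q2 : mu ^+ 2 / 2 <= q th.
    rewrite /q lerBrDr addrC -lerBrDr ler_pdivrMr//.
    have -> : (mu ^+ 2 - mu ^+ 2 / 2) * sin th ^+ 2 = e * mu ^+ 2 by rewrite /e; field.
    exact: ltW.
  have m20 : 0 < mu ^+ 2 / 2 by rewrite divr_gt0 ?exprn_gt0.
  have GE : mu ^+ 2 / 2 * U th <= A * mu.
    apply: (@le_trans _ _ (G th)).
      by rewrite /G (le_trans (ler_wpM2r (U0 hth) q2))// lerDr V0.
    apply: le_trans (G_le _) _; first by rewrite th0.
    apply: ler_wpM2l => //.
    have : Num.sqrt (mu ^+ 2 - B) <= Num.sqrt (mu ^+ 2) by apply: ler_wsqrtr; rewrite lerBlDr lerDl.
    by rewrite sqrtr_sqr gtr0_norm.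
  have h1 : U th <= 2 * A / mu.
    rewrite ler_pdivlMr// -(ler_pM2r mu0); move: GE; nra.
  apply: le_trans h1 _; rewrite ler_pdivrMr// mulrAC ler_pdivlMr ?mulr_gt0//.
  have h2 : sin th * Num.sqrt mu <= mu.
    by rewrite {2}smE expr2 (ler_pM2r sm0); lra.
  have := ler_wpM2l A0 h2; have := mulr_ge0 A0 (ltW mu0); have := A0; lra.
have B1 : 0 < B by apply: lt_le_trans eB; rewrite mulr_gt0 ?exprn_gt0.
(* a is th if B cos / w^3 <= 1/2 there, and otherwise the point further right where this quantity
   equals 1/2, a zero of [phi]. *)
have [a [tha ap Wa ka Ua]] : exists a, [/\ th <= a, a <= pi / 2, 0 < W a,
    2 * B * cos a <= w a ^+ 3 & U th <= 27 * A * (sin a / w a)].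
  have [/andP[Wth kth]|nk] := boolP ((0 < W th) && (2 * B * cos th <= w th ^+ 3)).
    exists th; split => //.
    have w0 : 0 < w th by rewrite sqrtr_gt0.
    have := HA _ Wth kth; rewrite th0 => /(_ thp) hH.
    have : w th / sin th * U th <= 8 / 3 * A.
      by apply: le_trans hH; rewrite /H lerDl mulr_ge0 ?V0// divr_ge0 ?ltW.
    rewrite mulrC -ler_pdivlMr ?divr_gt0// invf_div => h; apply: le_trans h _.
    apply: ler_wpM2r; first by rewrite divr_ge0// ltW.
    by have := A0; lra.
  pose phi t := 2 * B * cos t - w t ^+ 3.
  have cphi : continuous phi.
    move=> t; apply: cvgB.
      by apply: cvgM; [exact: cvg_cst|exact: continuous_cos].
    have cw : w x @[x --> t] --> w t.
      apply: (@continuous_comp _ _ _ W (@Num.sqrt R)); last first.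
        exact: (@sqrt_continuous R).
      have [dW1 _] := dW t; apply/differentiable_continuous.
      exact/derivable1_diffP.
    exact: (@continuous_comp _ _ _ w (fun x => x ^+ 3) t cw (@exprn_continuous _ 3 _)).
  (* Where [W th <= 0] the square root is 0 by convention, so [phi] stays continuous and is
     nonnegative there. *)
  have phi_th : 0 <= phi th.
    have c0 : 0 <= cos th by apply: cos0; rewrite (ltW th0).
    move: nk; rewrite negb_and -leNgt -ltNge => /orP[W0|]; last first.
      by rewrite /phi subr_ge0; exact: ltW.
    by rewrite /phi /w ler0_sqrtr// expr0n/= subr0 !mulr_ge0.
  have phi_pi : phi (pi / 2) < 0.
    rewrite /phi cos_pihalf mulr0 sub0r oppr_lt0 exprn_gt0//.
    by rewrite /w /W sin_pihalf expr1n mulr1.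
  have [|a] := @IVT R phi th (pi / 2) 0 thp (continuous_subspaceT cphi).
    by rewrite ge_min le_max phi_th (ltW phi_pi) orbT.
  rewrite in_itv/= => /andP[tha ap] /eqP; rewrite subr_eq0 => /eqP ka.
  have a0 : 0 < a by apply: lt_le_trans tha.
  have aN : a < pi / 2.
    rewrite lt_def ap andbT; apply/negP => /eqP aE.
    by move: phi_pi; rewrite /phi aE -ka subrr ltxx.
  have ca : 0 < cos a by apply: cos_gt0_pihalf; apply/andP; split; have := pi0; lra.
  have Wa : 0 < W a.
    rewrite -sqrtr_gt0 -/(w a) lt_def sqrtr_ge0 andbT; apply/negP => /eqP w0.
    by move: ka; rewrite w0 expr0n/= => /eqP; rewrite !mulf_eq0 !gt_eqF//= pnatr_eq0.
  exists a; split => //; first by rewrite ka.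
  have [Wth|Wth] := leP 0 (W th); first exact: (q_nonneg_bound th0).
  have [b [thb ba Wb Ub]] := q_neg_mono th0 tha ap Wth Wa.
  by apply: le_trans Ub _; apply: q_nonneg_bound => //; rewrite ?Wb//; lra.
have a0 : 0 < a by apply: lt_le_trans tha.
have e12 : 0 < e <= 2^-1 by rewrite e0 /e; lra.
have := q_lower a0 ap Wa ka e12 eB.
have w0 : 0 < w a by rewrite sqrtr_gt0.
have ha := lt0pi a0 ap; have sa := sin0 ha.
set r := w a / sin a => hr.
have r0 : 0 < r by rewrite divr_gt0.
(* r^2 >= mu sin^2 th / 2 and (27/40)^2 < 1/2; the constant 40 is 27 divided by 27/40. *)
have hr' : 27 / 40 * (sin th * Num.sqrt mu) <= r.
  have ss0 : 0 < sin th * Num.sqrt mu by rewrite mulr_gt0.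
  rewrite -ler_sqr ?nnegrE ?(ltW r0)//; last by rewrite mulr_ge0// ltW.
  apply: le_trans hr; rewrite !exprMn -smE /e.
  have := mulr_gt0 s20 mu0; lra.
apply: le_trans Ua _; have -> : sin a / w a = r^-1 by rewrite invf_div.
rewrite ler_pdivrMr// mulrAC ler_pdivlMr ?mulr_gt0//.
have := ler_wpM2l A0 hr'; lra.
Qed.

End oscillator.

(** * Gamma at half-integers and at its poles *)

Section gamma.
Variable R : realType.
Implicit Types x : R.

Let gauss x (n : nat) : R := n`!%:R * n%:R `^ x / \prod_(0 <= m < n.+1) (x + m%:R).

Let Gamma_gauss x : Gamma x = limn (gauss x).
Proof. by []. Qed.

Let cvg_ratio x : 0 <= x -> (n%:R / (x + n.+1%:R)) @[n --> \oo] --> (1 : R).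
Proof.
move=> x0; have h : (fun n : nat => 1 - (x + 1) * harmonic n : R) @ \oo --> (1 : R).
  rewrite -[X in _ --> X]subr0; apply: cvgB; first exact: cvg_cst.
  rewrite -[X in _ --> X](mulr0 (x + 1)); apply: cvgM; first exact: cvg_cst.
  exact: cvg_harmonic.
apply: (squeeze_cvgr _ h (cvg_cst _)); near=> n; rewrite /harmonic/=.
have n1 : 0 < n.+1%:R :> R by rewrite ltr0n.
have n2 : 0 < x + n.+1%:R by rewrite ltr_wpDl.
have -> : n%:R / (x + n.+1%:R) = 1 - (x + 1) / (x + n.+1%:R).
  by rewrite -natr1; field; rewrite gt_eqF// natr1.
rewrite lerD2l lerN2 gerDl oppr_le0 divr_ge0 ?andbT; [|lra|exact: ltW].
by rewrite ler_wpM2l ?lef_pV2 ?posrE// ?lerDr; lra.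
Unshelve. all: end_near. Qed.

Let gaussS x n : 0 < x -> (0 < n)%N ->
  gauss (x + 1) n = gauss x n * (x * (n%:R / (x + n.+1%:R))).
Proof.
move=> x0 n0.
have p0 k : 0 < \prod_(0 <= m < k) (x + m%:R).
  by apply: prodr_gt0 => i _; rewrite ltr_pwDl.
have E : \prod_(0 <= m < n.+1) (x + 1 + m%:R) =
    \prod_(0 <= m < n.+1) (x + m%:R) * (x + n.+1%:R) / x.
  rewrite -big_nat_recr//= [in RHS]big_nat_recl//= addr0 mulrC mulKf ?gt_eqF//.
  by apply: eq_bigr => i _; rewrite -natr1; ring.
rewrite /gauss E powRD; last by rewrite pnatr_eq0 -lt0n n0 implybT.
rewrite powRr1//; field.
by rewrite !gt_eqF//= ltr_pwDl.
Qed.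

Let cvg_gaussS x : 0 < x -> cvgn (gauss x) ->
  gauss (x + 1) @ \oo --> x * Gamma x.
Proof.
move=> x0 cx.
have h : (fun n => gauss x n * (x * (n%:R / (x + n.+1%:R)))) @ \oo --> Gamma x * (x * 1).
  by apply: cvgM => //; apply: cvgM; [exact: cvg_cst|apply: cvg_ratio; exact: ltW].
rewrite mulr1 mulrC in h; apply: cvg_trans h; apply: near_eq_cvg; near=> n.
by rewrite gaussS//; near: n; exact: nbhs_infty_gt.
Unshelve. all: end_near. Qed.

Let cvg_gauss1 : cvgn (gauss 1).
Proof.
apply/cvg_ex; exists (1 : R); have h := @cvg_ratio 0 (lexx _); apply: cvg_trans h.
apply: near_eq_cvg; near=> n.
have n0 : (0 < n)%N by near: n; exact: nbhs_infty_gt.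
have E k : \prod_(0 <= m < k) (1 + m%:R) = k`!%:R :> R.
  elim: k => [|k IH]; first by rewrite big_geq.
  by rewrite big_nat_recr//= IH factS natrM mulrC nat1r.
rewrite /gauss powRr1// E factS natrM add0r; field.
by rewrite nat1r !pnatr_eq0 -lt0n fact_gt0.
Unshelve. all: end_near. Qed.

Let half_prod n : R := \prod_(0 <= m < n.+1) (2^-1 + m%:R).

Let half_prod_gt0 n : 0 < half_prod n.
Proof. by apply: prodr_gt0 => i _; rewrite ltr_pwDl. Qed.

Let gauss_half n : gauss 2^-1 n = n`!%:R * Num.sqrt n%:R / half_prod n.
Proof. by rewrite /gauss powR12_sqrt. Qed.

Let half_prodS n : half_prod n.+1 = half_prod n * (3 / 2 + n%:R).
Proof.
by rewrite /half_prod big_nat_recr//= -[n.+1%:R]natr1; congr (_ * _); field.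
Qed.

(** The sign is that of (n + 1)^3 - n (n + 3/2)^2 = 3n/4 + 1. *)
Let gauss_half_nd (n : nat) : gauss 2^-1 n <= gauss 2^-1 n.+1.
Proof.
have hp := half_prod_gt0 n; have hp1 := half_prod_gt0 n.+1.
have f0 k : 0 < k`!%:R :> R by rewrite ltr0n fact_gt0.
have n0 : 0 <= n%:R :> R by [].
have n1 : 0 <= n.+1%:R :> R by [].
have n2 : 0 < 3 / 2 + n%:R :> R by rewrite ltr_pwDl.
rewrite -ler_sqr ?nnegrE !gauss_half; last 2 first.
- by rewrite divr_ge0 ?mulr_ge0// ltW.
- by rewrite divr_ge0 ?mulr_ge0// ltW.
rewrite !expr_div_n !exprMn !sqr_sqrtr// half_prodS factS natrM -natr1.
rewrite -subr_ge0; have := sqr_ge0 (n`!%:R / half_prod n); set k := _ ^+ 2 => k0.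
have -> : ((n%:R + 1) * n`!%:R) ^+ 2 * (n%:R + 1) / (half_prod n * (3 / 2 + n%:R)) ^+ 2 -
   n`!%:R ^+ 2 * n%:R / half_prod n ^+ 2 = k * (3 / 4 * n%:R + 1) / (3 / 2 + n%:R) ^+ 2.
  by rewrite /k; field; rewrite !gt_eqF//; move: n2; lra.
by rewrite divr_ge0 ?sqr_ge0// mulr_ge0//; lra.
Qed.

(** Replacing the factor n by n + 1 in the square makes the sequence nonincreasing, and its first
    term is 4. *)
Let gauss_half_le n : gauss 2^-1 n ^+ 2 <= 4.
Proof.
pose c k : R := (k`!%:R / half_prod k) ^+ 2 * (k%:R + 1).
have cS k : c k.+1 <= c k.
  have hp := half_prod_gt0 k.
  have n0 : 0 <= k%:R :> R by [].
  rewrite /c half_prodS factS natrM -natr1.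
  rewrite -subr_ge0; have := sqr_ge0 (k`!%:R / half_prod k); set d := _ ^+ 2 => k0.
  have -> : d * (k%:R + 1) - ((k%:R + 1) * k`!%:R / (half_prod k * (3 / 2 + k%:R))) ^+ 2 *
     (k%:R + 1 + 1) = d * (k%:R + 1) * 4^-1 / (3 / 2 + k%:R) ^+ 2.
    by rewrite /d; field; rewrite !gt_eqF//; lra.
  by rewrite divr_ge0 ?sqr_ge0// mulr_ge0// mulr_ge0// addr_ge0.
have c4 k : c k <= 4.
  elim: k => [|k IH]; last exact: le_trans (cS k) IH.
  by rewrite /c /half_prod big_nat1 fact0 addr0 add0r mulr1 div1r invrK; lra.
apply: le_trans (c4 n); rewrite gauss_half mulrAC exprMn sqr_sqrtr//.
by apply: ler_wpM2l; rewrite ?sqr_ge0 ?lerDl.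
Qed.

Let cvg_gauss_half : cvgn (gauss 2^-1).
Proof.
apply: nondecreasing_is_cvgn; first exact/nondecreasing_seqP.
exists 2 => _ [n _ <-]; have := gauss_half_le n.
have -> : 4 = 2 ^+ 2 :> R by ring.
rewrite ler_sqr ?nnegrE// gauss_half divr_ge0 ?mulr_ge0//.
by have := half_prod_gt0 n; exact: ltW.
Qed.

Let cvg_gauss N : cvgn (gauss (N.+1%:R / 2)).
Proof.
(* The functional equation moves N by 2, so two consecutive cases are carried along. *)
suff: cvgn (gauss (N.+1%:R / 2)) /\ cvgn (gauss (N.+2%:R / 2)) by case.
elim: N => [|N [h1 h2]].
  by rewrite div1r divff ?pnatr_eq0.
split => //; have -> : N.+3%:R / 2 = N.+1%:R / 2 + 1 :> R.
  by rewrite -(addn2 N.+1) natrD; field.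
by apply: cvgP; apply: cvg_gaussS => //; rewrite divr_gt0 ?ltr0n.
Qed.

Lemma Gamma_halfS N :
  Gamma (N.+1%:R / 2 + 1) = N.+1%:R / 2 * Gamma (N.+1%:R / 2) :> R.
Proof. by apply/cvg_lim => //; apply: cvg_gaussS; rewrite ?divr_gt0 ?ltr0n. Qed.

Lemma Gamma_nonpos n : Gamma (- n%:R) = 0 :> R.
Proof.
rewrite Gamma_gauss; apply/cvg_lim => //; apply: cvg_near_cst.
near=> k; rewrite /gauss.
suff -> : \prod_(0 <= m < k.+1) (- n%:R + m%:R : R) = 0 by rewrite invr0 mulr0.
have nk : (n < k.+1)%N by near: k; exact: nbhs_infty_ge.
by rewrite big_mkord (bigD1 (Ordinal nk))//= addNr mul0r.
Unshelve. all: end_near. Qed.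

End gamma.

(** * The binomial series with half-integer exponents *)

Section binomial_series.
Variable R : realType.
Implicit Types (a z : R).

Lemma pochS a n : poch a n.+1 = poch a n * (a + n%:R).
Proof. by rewrite /poch big_nat_recr. Qed.

Lemma poch0 a : poch a 0 = 1.
Proof. by rewrite /poch big_geq. Qed.

Lemma poch_gt0 a n : 0 < a -> 0 < poch a n.
Proof. by move=> a0; apply: prodr_gt0 => i _; rewrite ltr_pwDl. Qed.

Let c k : R := poch 2^-1 k / k`!%:R.

Let f0 k : 0 < k`!%:R :> R. Proof. by rewrite ltr0n fact_gt0. Qed.

Let cS k : c k.+1 = c k * (2^-1 + k%:R) / (k%:R + 1).
Proof.
rewrite /c pochS factS natrM -natr1; field.
by rewrite !gt_eqF// ltr_wpDl.
Qed.

Let c_ge0 k : 0 <= c k.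
Proof. by rewrite divr_ge0// ltW// poch_gt0. Qed.

Let c_le1 k : c k <= 1.
Proof.
elim: k => [|k IH]; first by rewrite /c poch0 fact0 divr1.
have k0 : 0 <= k%:R :> R by [].
rewrite cS ler_pdivrMr ?mul1r ?ltr_wpDl//.
apply: (@le_trans _ _ (1 * (2^-1 + k%:R))); first by rewrite ler_wpM2r// addr_ge0.
by rewrite mul1r addrC lerD2l; lra.
Qed.

Let T M x : R := \sum_(0 <= k < M) c k * x ^+ k.

(** (1 - x)^(-1/2) solves (1 - x) y' = y / 2; the term in [c M] is the truncation error. *)
Let dT M (x : R) : x < 1 ->
  is_derive x 1 (T M) ((T M x / 2 - M%:R * c M * x ^+ M.-1) / (1 - x)).
Proof.
move=> x1; have x1' : 1 - x != 0 by rewrite gt_eqF// subr_gt0.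
elim: M => [|M IH].
  rewrite (_ : T 0 = cst 0); last by apply/funext => y; rewrite /T big_geq.
  by apply: (is_derive_pt_eq (is_derive_cst (0 : R) x 1)); rewrite /=; field.
rewrite (_ : T M.+1 = fun y => T M y + c M * y ^+ M); last first.
  by apply/funext => y; rewrite /T big_nat_recr.
apply: (is_derive_pt_eq (is_derive_ptD IH
  (is_derive_ptM (is_derive_cst (c M) x 1) (is_derive_ptX M (is_derive_id x 1))))).
rewrite cS -natr1 /=; have hM : M%:R + 1 != 0 :> R by rewrite gt_eqF// ltr_wpDl.
case: M hM {IH} => [|M] hM /=; first by rewrite /T big_geq//; field; rewrite x1'.
by rewrite exprS; move: hM; rewrite -nat1r => hM; field; rewrite x1' hM.
Qed.

(** The product of a partial sum and sqrt (1 - x) starts at 1 and decreases; adding x^(M+1) / sqrt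
    (1 - z) makes it increase, because c <= 1. This squeezes it, with an error that vanishes as z <
    1. *)
Let binomial_half z : 0 <= z < 1 ->
  series (fun k => c k * z ^+ k) @ \oo --> (Num.sqrt (1 - z))^-1.
Proof.
move=> /andP[z0 z1].
have s0 x : x <= z -> 0 < Num.sqrt (1 - x) by move=> ?; rewrite sqrtr_gt0; lra.
have sz := s0 z (lexx z).
pose D M x := - (M%:R * c M * x ^+ M.-1 / Num.sqrt (1 - x)).
have dphi M (x : R) : x <= z -> is_derive x 1 (fun t => T M t * Num.sqrt (1 - t)) (D M x).
  move=> xz; have x1 : x < 1 by lra.
  have x1' : 0 < 1 - x by lra.
  have ds := is_derive1_comp (f := @Num.sqrt R) (g := fun t => 1 + - t) (is_derive1_sqrt x1')
    (is_derive_ptD (is_derive_cst (1 : R) x 1) (is_derive_ptN (is_derive_id x 1))).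
  apply: (is_derive_pt_eq (is_derive_ptM (dT M x x1) ds)).
  have sx := s0 x xz; rewrite /D /= add0r mulrN1.
  have -> : (1 - x) = Num.sqrt (1 - x) ^+ 2 by rewrite sqr_sqrtr// ltW.
  rewrite sqrtr_sqr gtr0_norm//; field; rewrite gt_eqF//.
have T0 M : T M.+1 0 * Num.sqrt (1 - 0) = 1.
  rewrite subr0 sqrtr1 mulr1 /T big_nat_recl// expr0 big1_seq ?addr0.
    by rewrite /c poch0 fact0 divr1 mulr1.
  by move=> i _; rewrite exprS mul0r mulr0.
have up M : T M.+1 z * Num.sqrt (1 - z) <= 1.
  rewrite -lerN2 -[in leLHS](T0 M).
  apply: (@nondecreasing_of_derive_cc R (fun t => - (T M.+1 t * Num.sqrt (1 - t)))
     (fun t => - D M.+1 t)) => // t /andP[h1 h2].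
    by apply: is_derive_ptN; apply: dphi.
  rewrite opprK; apply: divr_ge0; last exact: sqrtr_ge0.
  by apply: mulr_ge0; [exact: mulr_ge0|rewrite exprn_ge0// ltW].
have lo M : 1 - z ^+ M.+1 / Num.sqrt (1 - z) <= T M.+1 z * Num.sqrt (1 - z).
  rewrite lerBlDr.
  apply: (@le_trans _ _ (T M.+1 0 * Num.sqrt (1 - 0) + 0 ^+ M.+1 * (Num.sqrt (1 - z))^-1)).
    by rewrite T0 expr0n mul0r addr0.
  apply: (@nondecreasing_of_derive_cc R
     (fun t => T M.+1 t * Num.sqrt (1 - t) + t ^+ M.+1 * (Num.sqrt (1 - z))^-1)
     (fun t => D M.+1 t + M.+1%:R * t ^+ M / Num.sqrt (1 - z))) => // t /andP[h1 h2].
    apply: (is_derive_pt_eq (is_derive_ptD (dphi _ _ h2)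
     (is_derive_ptM (is_derive_ptX M.+1 (is_derive_id t 1)) (is_derive_cst ((Num.sqrt (1 - z))^-1) t 1)))).
    by rewrite /= mulr1 mulr0 addr0.
  rewrite /D addrC subr_ge0; apply: ler_pM.
  - by apply: mulr_ge0; [exact: mulr_ge0|rewrite exprn_ge0// ltW].
  - by rewrite invr_ge0 sqrtr_ge0.
  - by rewrite ler_wpM2r ?exprn_ge0 ?(ltW h1)// ler_piMr.
  - by rewrite lef_pV2 ?posrE ?s0 ?(ltW h2)// ler_wsqrtr//; lra.
rewrite -(cvg_shiftn 1).
have lim1 : (fun M => (1 - z ^+ M.+1 / Num.sqrt (1 - z)) / Num.sqrt (1 - z)) @ \oo -->
    (1 - 0 / Num.sqrt (1 - z)) / Num.sqrt (1 - z).
  apply: cvgM; last exact: cvg_cst.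
  apply: cvgB; first exact: cvg_cst.
  apply: cvgM; last exact: cvg_cst.
  have := @cvg_expr R z; rewrite ger0_norm// => /(_ z1) h.
  by rewrite -(cvg_shiftn 1) in h; move: h; under eq_fun do rewrite addn1.
rewrite mul0r subr0 mul1r in lim1.
apply: (squeeze_cvgr _ lim1 (cvg_cst _)); near=> M.
rewrite /= addn1 -[series _ _]/(T M.+1 z) ler_pdivrMr// lo/=.
by rewrite -[leRHS]div1r ler_pdivlMr// up.
Unshelve. all: end_near. Qed.

Lemma cvg_binomial_series z N : 0 <= z < 1 ->
  series (fun k => poch (- ((N%:R - 1) / 2)) k / k`!%:R * z ^+ k) @ \oo -->
  Num.sqrt (1 - z) ^+ N / Num.sqrt (1 - z).
Proof.
move=> hz; have /andP[z0 z1] := hz.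
have sz : 0 < Num.sqrt (1 - z) by rewrite sqrtr_gt0 subr_gt0.
pose F N := series (fun k => poch (- ((N%:R - 1) / 2)) k / k`!%:R * z ^+ k).
rewrite -/(F N).
suff: F N @ \oo --> Num.sqrt (1 - z) ^+ N / Num.sqrt (1 - z) /\
  F N.+1 @ \oo --> Num.sqrt (1 - z) ^+ N.+1 / Num.sqrt (1 - z) by case.
elim: N => [|N [h1 h2]]; split => //.
- rewrite expr0 div1r /F (_ : - ((0 - 1) / 2) = 2^-1); last by field.
  exact: binomial_half.
- rewrite expr1 divff ?gt_eqF// -(cvg_shiftn 1) /F.
  apply: cvg_near_cst; near=> M; rewrite /= addn1 /series/= big_nat_recl// big1_seq.
    by rewrite poch0 fact0 divr1 mulr1 addr0.
  move=> i _; rewrite subrr mul0r oppr0 /poch big_nat_recl// addr0.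
  by rewrite !mul0r.
(* Raising the exponent by 1 is multiplication by 1 - z, exact on partial sums; the base cases are
   the exponents -1/2 and 0. *)
have FE M : F N.+2 M.+1 = F N M.+1 - z * F N M.
  elim: M => [|M IH].
    rewrite /F /series/= !big_nat1 big_geq// mulr0 subr0.
    by rewrite !poch0.
  have E K L : F K L.+1 = F K L + poch (- ((K%:R - 1) / 2)) L / L`!%:R * z ^+ L.
    by rewrite /F /series/= big_nat_recr.
  rewrite (E N.+2) IH (E N M.+1) (E N M).
  set m := (N%:R - 1) / 2.
  have -> : (N.+2%:R - 1) / 2 = m + 1 :> R by rewrite /m -(addn2 N) natrD; field.
  have P1 : poch (- (m + 1)) M.+1 = poch (- m) M * (- (m + 1)).
    by rewrite /poch big_nat_recl//= addr0 mulrC; congr (_ * _); apply: eq_bigr => i _;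
      rewrite -natr1; ring.
  rewrite P1 pochS factS natrM exprS -natr1.
  have hM : M%:R + 1 != 0 :> R by rewrite gt_eqF// ltr_wpDl.
  by field; rewrite hM gt_eqF.
rewrite -(cvg_shiftn 1).
have -> : [sequence F N.+2 (n + 1)%N]_n = (fun n => F N n.+1 - z * F N n).
  by apply/funext => n; rewrite /= addn1 FE.
have -> : Num.sqrt (1 - z) ^+ N.+2 / Num.sqrt (1 - z) =
   Num.sqrt (1 - z) ^+ N / Num.sqrt (1 - z) - z * (Num.sqrt (1 - z) ^+ N / Num.sqrt (1 - z)).
  have -> : z = 1 - Num.sqrt (1 - z) ^+ 2 by rewrite sqr_sqrtr ?subr_ge0 ?(ltW z1)//; ring.
  rewrite opprB addrCA subrr addr0 sqrtr_sqr gtr0_norm// !exprS; ring.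
apply: cvgB; last by apply: cvgM => //; exact: cvg_cst.
by rewrite -(cvg_shiftn 1) in h1; move: h1; under eq_fun do rewrite addn1.
Unshelve. all: end_near. Qed.

End binomial_series.

(** * Gegenbauer polynomials normalised at 1 *)

Section gegenbauer.
Variable R : realType.

(** The second component is the preceding polynomial; its value 0 at n = 0 is only ever multiplied
    by 0. *)
Fixpoint geg_pair (N n : nat) : {poly R} * {poly R} :=
  if n is n'.+1 then
    ((N + n')%:R^-1 *: ((N + 2 * n')%:R *: ('X * (geg_pair N n').1)
       - n'%:R *: (geg_pair N n').2),
     (geg_pair N n').1)
  else (1, 0).

(* [geg N n] is C_n^(N/2) / C_n^(N/2)(1). *)
Definition geg (N n : nat) : {poly R} := locked (geg_pair N n).1.

Lemma geg0 N : geg N 0 = 1. Proof. by rewrite /geg -lock. Qed.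

Lemma geg_rec N n : (0 < N)%N ->
  (N + n)%:R *: geg N n.+1 =
  (N + 2 * n)%:R *: ('X * geg N n) - n%:R *: geg N n.-1.
Proof.
move=> N0; rewrite /geg -!lock /= scalerA mulfV ?scale1r; last first.
  by rewrite pnatr_eq0; lia.
by case: n => [|n]/=; rewrite ?scale0r.
Qed.

Lemma geg_recE N n x : (0 < N)%N ->
  (N + n)%:R * (geg N n.+1).[x] =
  (N + 2 * n)%:R * x * (geg N n).[x] - n%:R * (geg N n.-1).[x].
Proof.
move=> N0; have := congr1 (horner^~ x) (geg_rec N n N0).
by rewrite hornerD hornerN !hornerZ hornerM hornerX mulrA.
Qed.

Lemma natr_add_neq0 N n : (0 < N)%N -> (N + n)%:R != 0 :> R.
Proof. by move=> N0; rewrite pnatr_eq0; lia. Qed.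

(** Each relation at n + 1 follows from both at n, hence the joint induction. The factor n in the
    second one makes it hold at n = 0, where [n.-1] is 0. *)
Lemma geg_deriv_pair N n x : (0 < N)%N ->
  (1 - x ^+ 2) * (geg N n)^`().[x] = n%:R * ((geg N n.-1).[x] - x * (geg N n).[x]) /\
  n%:R * ((1 - x ^+ 2) * (geg N n.-1)^`().[x]) =
    n%:R * (n%:R + N%:R - 1) * (x * (geg N n.-1).[x] - (geg N n).[x]).
Proof.
move=> N0; elim: n => [|n [A B]].
  by rewrite geg0 -polyC1 derivC horner0 mulr0 !mul0r.
have E := geg_recE N n x N0.
have E' : (N + n)%:R * (geg N n.+1)^`().[x] =
  (N + 2 * n)%:R * ((geg N n).[x] + x * (geg N n)^`().[x]) - n%:R * (geg N n.-1)^`().[x].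
  have := congr1 (fun p => p^`().[x]) (geg_rec N n N0).
  rewrite /= derivB !derivZ derivM derivX mul1r hornerD hornerN !hornerZ hornerD hornerM hornerX.
  by move=> ->.
have h := natr_add_neq0 N n N0.
rewrite natrD in h E E'; rewrite natrD natrM in E E'.
rewrite /= -[n.+1%:R]natr1; split.
  apply: (mulfI h); rewrite mulrCA E'.
  have -> : (1 - x ^+ 2) * ((N%:R + 2 * n%:R) * ((geg N n).[x] + x * (geg N n)^`().[x])
      - n%:R * (geg N n.-1)^`().[x]) =
    (N%:R + 2 * n%:R) * ((1 - x ^+ 2) * (geg N n).[x] + x * ((1 - x ^+ 2) * (geg N n)^`().[x]))
     - n%:R * ((1 - x ^+ 2) * (geg N n.-1)^`().[x]) by ring.
  rewrite B A.
  have -> : (N%:R + n%:R) * ((n%:R + 1) * ((geg N n).[x] - x * (geg N n.+1).[x])) =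
   (n%:R + 1) * ((N%:R + n%:R) * (geg N n).[x] - x * ((N%:R + n%:R) * (geg N n.+1).[x])) by ring.
  by rewrite E; ring.
rewrite A.
have -> : (n%:R + 1) * (n%:R + 1 + N%:R - 1) * (x * (geg N n).[x] - (geg N n.+1).[x]) =
  (n%:R + 1) * ((N%:R + n%:R) * x * (geg N n).[x] - (N%:R + n%:R) * (geg N n.+1).[x]) by ring.
by rewrite E; ring.
Qed.

Lemma geg_opp N n x : (0 < N)%N -> (geg N n).[- x] = (-1) ^+ n * (geg N n).[x].
Proof.
move=> N0.
suff: (geg N n).[- x] = (-1) ^+ n * (geg N n).[x] /\
  (geg N n.+1).[- x] = (-1) ^+ n.+1 * (geg N n.+1).[x] by case.
elim: n => [|n [A B]]; split => //.
- by rewrite geg0 expr0 mul1r -polyC1 !hornerC.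
- apply: (mulfI (natr_add_neq0 N 0 N0)).
  by rewrite mulrCA !geg_recE// geg0 -polyC1 !hornerC; ring.
- apply: (mulfI (natr_add_neq0 N n.+1 N0)); rewrite mulrCA !geg_recE// A B !exprS; ring.
Qed.

Lemma geg_1 N n : (0 < N)%N -> (geg N n).[1] = 1.
Proof.
move=> N0; suff: (geg N n).[1] = 1 /\ (geg N n.+1).[1] = 1 by case.
have h n' := natr_add_neq0 N n' N0.
elim: n => [|n [A B]]; split => //.
- by rewrite geg0 -polyC1 hornerC.
- by apply: (mulfI (h 0)); rewrite geg_recE// geg0 -polyC1 hornerC addn0; ring.
- by apply: (mulfI (h n.+1)); rewrite geg_recE// A B !natrD natrM; ring.
Qed.

End gegenbauer.

(** * The recurrence in the degree for Ferrers functions *)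

Section legendre_series.
Variable R : realType.
Implicit Types (nu m z : R).

Definition leg_term nu m z (k : nat) : R :=
  poch (nu + 1) k * poch (- nu) k / (Gamma (1 + m + k%:R) * k`!%:R) * z ^+ k.

Lemma hypF_leg nu m z : hypF (nu + 1) (- nu) (1 + m) z = limn (series (leg_term nu m z)).
Proof. by []. Qed.

Lemma poch_recl (a : R) n : poch a n.+1 = a * poch (a + 1) n.
Proof.
rewrite /poch big_nat_recl// addr0; congr (_ * _); apply: eq_bigr => i _.
by rewrite -natr1; ring.
Qed.

Variable m : R.
(** In reciprocal form the functional equation also covers the poles, where 1 / Gamma is 0. *)
Hypothesis GammaS : forall k : nat,
  (Gamma (1 + m + k%:R))^-1 = (1 + m + k%:R) * (Gamma (1 + m + k.+1%:R))^-1.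

(** This is the coefficient form of (nu - mu + 1) P_(nu+1) = (2 nu + 1) x P_nu - (nu + mu) P_(nu-1)
    with mu = - m and x = 1 - 2z. *)
Lemma leg_term_rec nu z k :
  (nu + m + 1) * leg_term (nu + 1) m z k.+1 =
  (2 * nu + 1) * (leg_term nu m z k.+1 - 2 * z * leg_term nu m z k)
  - (nu - m) * leg_term (nu - 1) m z k.+1.
Proof.
have f0 : k`!%:R != 0 :> R by rewrite pnatr_eq0 -lt0n fact_gt0.
have k0 : k%:R + 1 != 0 :> R by rewrite natr1 pnatr_eq0.
pose X := poch (nu + 1) k; pose Y := poch (- nu) k.
have a1 : poch (nu + 1) k.+1 = X * (nu + 1 + k%:R) by rewrite pochS.
have a2 : poch (- nu) k.+1 = Y * (- nu + k%:R) by rewrite pochS.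
have a3 : poch (nu + 1 + 1) k.+1 * (nu + 1) = X * (nu + 1 + k%:R) * (nu + 1 + k%:R + 1).
  by rewrite [LHS]mulrC -poch_recl !pochS -natr1 /X; ring.
have a4 : poch (- (nu + 1)) k.+1 = - (nu + 1) * Y.
  by rewrite poch_recl /Y; congr (_ * poch _ _); ring.
have a5 : poch (nu - 1 + 1) k.+1 = nu * X.
  by rewrite poch_recl /X subrK.
have a6 : poch (- (nu - 1)) k.+1 * (- nu) = Y * (- nu + k%:R) * (- nu + k%:R + 1).
  rewrite [LHS]mulrC (_ : - (nu - 1) = - nu + 1); last by ring.
  by rewrite -poch_recl !pochS -natr1 /Y; ring.
rewrite /leg_term !invfM (GammaS k).
set d := (Gamma _)^-1.
rewrite a1 a2 factS natrM -natr1 exprS.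
have -> : poch (nu + 1 + 1) k.+1 * poch (- (nu + 1)) k.+1 =
   - (X * (nu + 1 + k%:R) * (nu + 1 + k%:R + 1)) * Y by rewrite a4 -a3; ring.
have -> : poch (nu - 1 + 1) k.+1 * poch (- (nu - 1)) k.+1 =
   - X * (Y * (- nu + k%:R) * (- nu + k%:R + 1)) by rewrite a5 -a6; ring.
rewrite -/X -/Y; field.
by rewrite f0 k0.
Qed.

Lemma leg_series_rec nu z M :
  (nu + m + 1) * series (leg_term (nu + 1) m z) M.+1 =
  (2 * nu + 1) * (series (leg_term nu m z) M.+1 - 2 * z * series (leg_term nu m z) M)
  - (nu - m) * series (leg_term (nu - 1) m z) M.+1.
Proof.
pose F c L := series (leg_term c m z) L; rewrite -!/(F _ _).
have E c L : F c L.+1 = F c L + leg_term c m z L by rewrite /F seriesSr.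
elim: M => [|M IH].
  rewrite !E /F /series/= !big_geq// /leg_term !poch0 fact0 !expr0; ring.
rewrite (E _ M.+1) mulrDr IH leg_term_rec (E nu M.+1) (E _ M.+1) (E nu M).
ring.
Qed.

(** The factor nu - m stays inside the limit b: when nu = m it annihilates the series of degree nu -
    1, about which nothing is known. *)
Lemma cvg_leg_series_rec nu z a b : nu + m + 1 != 0 ->
  series (leg_term nu m z) @ \oo --> a ->
  (fun M => (nu - m) * series (leg_term (nu - 1) m z) M) @ \oo --> b ->
  series (leg_term (nu + 1) m z) @ \oo -->
    ((2 * nu + 1) * (1 - 2 * z) * a - b) / (nu + m + 1).
Proof.
move=> h ha hb; rewrite -(cvg_shiftn 1).
have -> : [sequence series (leg_term (nu + 1) m z) (n + 1)%N]_n = (fun M =>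
  ((2 * nu + 1) * (series (leg_term nu m z) M.+1 - 2 * z * series (leg_term nu m z) M)
  - (nu - m) * series (leg_term (nu - 1) m z) M.+1) * (nu + m + 1)^-1).
  apply/funext => M; rewrite -leg_series_rec /= addn1.
  by rewrite mulrAC divff// mul1r.
have -> : (2 * nu + 1) * (1 - 2 * z) * a = (2 * nu + 1) * (a - 2 * z * a) by ring.
apply: cvgM; last exact: cvg_cst.
apply: cvgB; last first.
  by rewrite -(cvg_shiftn 1) in hb; move: hb; under eq_fun do rewrite addn1.
apply: cvgM; first exact: cvg_cst.
apply: cvgB; last by apply: cvgM => //; exact: cvg_cst.
by rewrite -(cvg_shiftn 1) in ha; move: ha; under eq_fun do rewrite addn1.
Qed.

End legendre_series.

(** * Summation of the hypergeometric functions *)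

Section hypergeometric_values.
Variable R : realType.
Implicit Types (z : R).

Lemma Gamma_half_invS N :
  (Gamma (N.+1%:R / 2) : R)^-1 = N.+1%:R / 2 * (Gamma (N.+1%:R / 2 + 1))^-1.
Proof. by rewrite Gamma_halfS invfM mulrA divff ?mul1r// gt_eqF// divr_gt0 ?ltr0n. Qed.

Lemma Gamma_natS n : Gamma (n.+1%:R : R) = n`!%:R * Gamma 1.
Proof.
elim: n => [|n IH]; first by rewrite fact0 mul1r.
have := Gamma_halfS R (2 * n).+1.
have -> : (2 * n).+2%:R / 2 = n.+1%:R :> R.
  by rewrite -(addn2 (2 * n)) natrD natrM -natr1; field.
by rewrite natr1 IH factS natrM mulrA.
Qed.

(** For n = 0, (m + 1)_k / Gamma(1 + m + k) = 1 / Gamma(1 + m) and a binomial series is left; from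
    there the recurrence in the degree is that of [geg]. *)
Lemma hypF_geg z N n : (0 < N)%N -> 0 <= z < 1 ->
  hypF ((N%:R - 1) / 2 + n%:R + 1) (- ((N%:R - 1) / 2 + n%:R)) (1 + (N%:R - 1) / 2) z =
  Num.sqrt (1 - z) ^+ N / Num.sqrt (1 - z) / Gamma (1 + (N%:R - 1) / 2) *
    (geg R N n).[1 - 2 * z].
Proof.
move=> N0 hz; set m := (N%:R - 1) / 2.
have GS k : (Gamma (1 + m + k%:R))^-1 = (1 + m + k%:R) * (Gamma (1 + m + k.+1%:R))^-1.
  have := Gamma_half_invS (N + 2 * k).
  have -> : (N + 2 * k).+1%:R / 2 = 1 + m + k%:R :> R.
    by rewrite -natr1 natrD natrM /m; field.
  by rewrite (_ : 1 + m + k%:R + 1 = 1 + m + k.+1%:R)// -natr1 addrA.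
set C := _ / Gamma _.
have base : series (leg_term R m m z) @ \oo --> C.
  rewrite (_ : leg_term R m m z = fun k => (poch (- m) k / k`!%:R * z ^+ k) * (Gamma (1 + m))^-1).
    rewrite (_ : series _ = fun M => series (fun k => poch (- m) k / k`!%:R * z ^+ k) M * (Gamma (1 + m))^-1).
      by apply: cvgM; [exact: cvg_binomial_series|exact: cvg_cst].
    by apply/funext => M; rewrite /series/= mulr_suml.
  apply/funext => k.
  have E : (Gamma (1 + m))^-1 = poch (m + 1) k * (Gamma (1 + m + k%:R))^-1.
    elim: k => [|k IH]; first by rewrite poch0 mul1r addr0.
    by rewrite IH pochS GS; ring.
  by rewrite E /leg_term invfM; ring.
suff main : forall n, series (leg_term R (m + n%:R) m z) @ \oo --> C * (geg R N n).[1 - 2 * z] /\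
    series (leg_term R (m + n.+1%:R) m z) @ \oo --> C * (geg R N n.+1).[1 - 2 * z].
  by rewrite hypF_leg; apply/cvg_lim => //; have [] := main n.
have step k b : series (leg_term R (m + k%:R) m z) @ \oo --> C * (geg R N k).[1 - 2 * z] ->
    (fun M => k%:R * series (leg_term R (m + k%:R - 1) m z) M) @ \oo --> b ->
    b = k%:R * C * (geg R N k.-1).[1 - 2 * z] ->
    series (leg_term R (m + k.+1%:R) m z) @ \oo --> C * (geg R N k.+1).[1 - 2 * z].
  move=> h1 h2 be.
  have nz := natr_add_neq0 R N k N0.
  have nz' : m + k%:R + m + 1 = (N + k)%:R by rewrite natrD /m; field.
  have mk : m + k%:R - m = k%:R by ring.
  have := @cvg_leg_series_rec R m GS (m + k%:R) z _ b _ h1 _.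
  rewrite nz' mk => /(_ nz h2).
  have -> : m + k%:R + 1 = m + k.+1%:R by rewrite -natr1 addrA.
  rewrite be.
  have -> // : ((2 * (m + k%:R) + 1) * (1 - 2 * z) * (C * (geg R N k).[1 - 2 * z]) -
     k%:R * C * (geg R N k.-1).[1 - 2 * z]) / (N + k)%:R = C * (geg R N k.+1).[1 - 2 * z].
  apply: (mulIf nz); rewrite divfK//.
  have -> : 2 * (m + k%:R) + 1 = (N + 2 * k)%:R by rewrite natrD natrM /m; field.
  have := geg_recE R N k (1 - 2 * z) N0 => E.
  have -> : C * (geg R N k.+1).[1 - 2 * z] * (N + k)%:R =
    C * ((N + k)%:R * (geg R N k.+1).[1 - 2 * z]) by ring.
  by rewrite E; ring.
elim=> [|k [h1 h2]]; split.
- by rewrite addr0 geg0 -polyC1 hornerC mulr1.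
- apply: (@step 0%N 0).
  + by rewrite addr0 geg0 -polyC1 hornerC mulr1.
  + by under eq_fun do rewrite mul0r; exact: cvg_cst.
  + by rewrite !mul0r.
- by [].
- apply: (@step k.+1 (k.+1%:R * C * (geg R N k).[1 - 2 * z])) => //.
  have -> : m + k.+1%:R - 1 = m + k%:R by rewrite -natr1; ring.
  by rewrite -mulrA; apply: cvgM => //; exact: cvg_cst.
Qed.

Lemma poch_neg_nat (M k : nat) : (M < k)%N -> poch (- M%:R : R) k = 0.
Proof.
by move=> Mk; rewrite /poch big_mkord (bigD1 (Ordinal Mk))//= addNr mul0r.
Qed.

Lemma poch_negn M : poch (- M%:R : R) M = (-1) ^+ M * M`!%:R.
Proof.
elim: M => [|M IH]; first by rewrite poch0 fact0 mulr1.
rewrite poch_recl (_ : - M.+1%:R + 1 = - M%:R :> R); last by rewrite -natr1; ring.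
by rewrite IH factS natrM exprS; ring.
Qed.

Lemma poch_fact M k : poch (M%:R + 1 : R) k = (M + k)`!%:R / M`!%:R.
Proof.
have f0 : M`!%:R != 0 :> R by rewrite pnatr_eq0 -lt0n fact_gt0.
elim: k => [|k IH]; first by rewrite poch0 addn0 divff.
by rewrite pochS IH addnS factS natrM -natr1 natrD; field.
Qed.

(* 1 / Gamma vanishes at 1 - M + k for k < M, so the series starts at z^M. *)
Lemma hypF_geg_neg z M n : (0 < M)%N ->
  hypF (M%:R + n%:R + 1) (- (M%:R + n%:R)) (1 - M%:R) z =
  (-1) ^+ M * z ^+ M / (n`!%:R * (M`!%:R * Gamma 1)) * (2 * M + n)`!%:R *
    (geg R (2 * M).+1 n).[1 - 2 * z].
Proof.
move=> M0; pose m : R := - M%:R.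
have f0 k : k`!%:R != 0 :> R by rewrite pnatr_eq0 -lt0n fact_gt0.
have G0 k : (k < M)%N -> Gamma (1 + m + k%:R) = 0.
  move=> kM; rewrite (_ : 1 + m + k%:R = - (M - k.+1)%:R) ?Gamma_nonpos//.
  by rewrite natrB// -natr1 /m; ring.
have GS k : (Gamma (1 + m + k%:R))^-1 = (1 + m + k%:R) * (Gamma (1 + m + k.+1%:R))^-1.
  have [kM|Mk] := ltnP k M.
    rewrite G0// invr0; have [kM'|kM'] := ltnP k.+1 M.
      by rewrite G0// invr0 mulr0.
    (* At k = M - 1 the left side is 1 / Gamma(0) = 0 and the factor on the right vanishes. *)
    have e : M%:R = k%:R + 1 :> R by rewrite natr1; congr _%:R; lia.
    by rewrite {1}/m e; ring.
  have := Gamma_half_invS (2 * (k - M)).+1.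
  have -> : (2 * (k - M)).+2%:R / 2 = 1 + m + k%:R :> R.
    by rewrite -(addn2 (2 * _)) natrD natrM natrB// /m; field.
  by rewrite (_ : 1 + m + k%:R + 1 = 1 + m + k.+1%:R)// -natr1 addrA.
pose t := (2 * M)`!%:R * (-1) ^+ M * z ^+ M / (M`!%:R * Gamma 1).
have tE : leg_term R M%:R m z M = t.
  rewrite /leg_term poch_fact poch_negn /m.
  rewrite (_ : 1 - M%:R + M%:R = 1) ?subrK// /t addnn mul2n !invfM; set d := (Gamma 1)^-1.
  by field; rewrite f0.
have base : series (leg_term R M%:R m z) @ \oo --> t.
  rewrite -(cvg_shiftn M.+1); apply: cvg_near_cst; near=> k.
  rewrite /= /series/= big_mkord.
  have Mk : (M < k + M.+1)%N by rewrite addnS ltnS leq_addl.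
  rewrite (bigD1 (Ordinal Mk))//= tE big1 ?addr0// => i; rewrite -val_eqE/= => iM.
  have [h|h] := ltnP i M; first by rewrite /leg_term G0// mul0r invr0 mulr0 mul0r.
  by rewrite /leg_term poch_neg_nat ?mulr0 ?mul0r//; lia.
(* One degree lower nothing survives: 1 / Gamma kills k < M and (1 - M)_k kills k >= M. The
   recurrence thus starts with predecessor 0. *)
have base0 : leg_term R (M%:R - 1) m z = fun=> 0.
  apply/funext => k; rewrite /leg_term.
  have [h|h] := ltnP k M; first by rewrite G0// mul0r invr0 mulr0 mul0r.
  rewrite (_ : - (M%:R - 1) = - M.-1%:R).
    by rewrite poch_neg_nat ?mulr0 ?mul0r// prednK.
  by rewrite -[in LHS](prednK M0) -natr1; ring.
(* The binomial coefficient that turns the coefficients k + 1 and 2M + k of the recurrence into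
   those of [geg] for N = 2M + 1. *)
pose e k : R := (2 * M + k)`!%:R / (k`!%:R * (2 * M)`!%:R).
have eS k : e k.+1 * k.+1%:R = e k * ((2 * M).+1 + k)%:R.
  have k0 : k.+1%:R != 0 :> R by rewrite pnatr_eq0.
  rewrite /e addnS !factS !natrM addSn; move: k.+1%:R k0 => x x0.
  by field; rewrite !f0.
pose g k := (geg R (2 * M).+1 k).[1 - 2 * z].
have step k b : series (leg_term R (M%:R + k%:R) m z) @ \oo --> t * e k * g k ->
    (fun L => (2 * M + k)%:R * series (leg_term R (M%:R + k%:R - 1) m z) L) @ \oo --> b ->
    b = t * e k * k%:R * g k.-1 ->
    series (leg_term R (M%:R + k.+1%:R) m z) @ \oo --> t * e k.+1 * g k.+1.
  move=> h1 h2 be.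
  have nz : k.+1%:R != 0 :> R by rewrite pnatr_eq0.
  have nz' : M%:R + k%:R + m + 1 = k.+1%:R by rewrite -natr1 /m; ring.
  have mk : M%:R + k%:R - m = (2 * M + k)%:R by rewrite natrD natrM /m; ring.
  have := @cvg_leg_series_rec R m GS (M%:R + k%:R) z _ b _ h1 _.
  rewrite nz' mk => /(_ nz h2).
  have -> : M%:R + k%:R + 1 = M%:R + k.+1%:R :> R by rewrite -natr1 addrA.
  rewrite be.
  have -> // : ((2 * (M%:R + k%:R) + 1) * (1 - 2 * z) * (t * e k * g k) -
     t * e k * k%:R * g k.-1) / k.+1%:R = t * e k.+1 * g k.+1.
  apply: (mulIf nz); rewrite divfK//.
  have E : ((2 * M).+1 + k)%:R * g k.+1 = ((2 * M).+1 + 2 * k)%:R * (1 - 2 * z) * g k -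
    k%:R * g k.-1 by exact: geg_recE.
  have -> : t * e k.+1 * g k.+1 * k.+1%:R = t * (e k.+1 * k.+1%:R) * g k.+1 by ring.
  have -> : t * (e k.+1 * k.+1%:R) * g k.+1 = t * e k * (((2 * M).+1 + k)%:R * g k.+1).
    by rewrite eS; ring.
  have -> : (2 * (M%:R + k%:R) + 1 : R) = ((2 * M).+1 + 2 * k)%:R.
    by rewrite addSn -[(2 * M + 2 * k).+1%:R]natr1 natrD !natrM; ring.
  by rewrite E; ring.
suff main : forall n, series (leg_term R (M%:R + n%:R) m z) @ \oo --> t * e n * g n /\
    series (leg_term R (M%:R + n.+1%:R) m z) @ \oo --> t * e n.+1 * g n.+1.
  rewrite hypF_leg; apply/cvg_lim => //; have [h _] := main n.
  rewrite (_ : _ * _ = t * e n * g n)// /t /e /g !invfM; congr (_ * _).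
  by set d := (Gamma 1)^-1; field; rewrite !f0.
have e0 : e 0%N = 1 by rewrite /e addn0 fact0 mul1r divff.
elim=> [|k [h1 h2]]; split.
- by rewrite addr0 e0 /g geg0 -polyC1 hornerC !mulr1.
- apply: (@step 0%N 0).
  + by rewrite addr0 e0 /g geg0 -polyC1 hornerC !mulr1.
  + rewrite addr0 base0 (_ : (fun L => _) = cst 0); first exact: cvg_cst.
    by apply/funext => L; rewrite /series/= big1// mulr0.
  + by rewrite mulr0 mul0r.
- by [].
- apply: (@step k.+1 ((2 * M + k.+1)%:R * (t * e k * g k))) => //.
    have -> : M%:R + k.+1%:R - 1 = M%:R + k%:R :> R by rewrite -natr1; ring.
    by apply: cvgM => //; exact: cvg_cst.
  by rewrite -[t * e k.+1 * _]mulrA eS addSnnS /=; ring.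
Unshelve. all: end_near. Qed.

End hypergeometric_values.

(** * The pointwise bound for weighted Gegenbauer polynomials *)

Section gegenbauer_bound.
Variable R : realType.

(* Up to a constant, the inverse of the squared L^2 norm of sin^(N/2) geg(cos)
   on [0, pi], divided by n + N/2. *)
Definition geg_weight (N n : nat) : R :=
  (N + n).-1`!%:R / (n`!%:R * 2 ^+ N.-1) * (Gamma (N.+1%:R / 2))^-1 ^+ 2.

Let f0 k : k`!%:R != 0 :> R. Proof. by rewrite pnatr_eq0 -lt0n fact_gt0. Qed.

Lemma geg_weight_ge0 N n : 0 <= geg_weight N n.
Proof. by rewrite mulr_ge0 ?sqr_ge0// divr_ge0// mulr_ge0// exprn_ge0. Qed.

Lemma geg_weightS N n : (0 < N)%N -> geg_weight N n.+1 * n.+1%:R = geg_weight N n * (N + n)%:R.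
Proof.
case: N => // N _; have k0 : n.+1%:R != 0 :> R by rewrite pnatr_eq0.
rewrite /geg_weight !addSn !addnS /= !factS !natrM.
set d := (Gamma _)^-1; move: n.+1%:R k0 => x x0.
by field; rewrite f0 x0 expf_neq0 ?pnatr_eq0.
Qed.

Lemma geg_weight0SS N : (0 < N)%N -> geg_weight N.+2 0 * N.+1%:R = geg_weight N 0 * N%:R.
Proof.
case: N => // N _; have N2 : N.+2%:R != 0 :> R by rewrite pnatr_eq0.
have e : (N.+1.+2).+1%:R / 2 = N.+2%:R / 2 + 1 :> R.
  by rewrite -(addn2 N.+2) natrD; field.
rewrite /geg_weight e Gamma_halfS /= !addn0 /= !factS !natrM fact0 !exprS !mul1r [(_ / _ * Gamma _)^-1]invfM.
set d := (Gamma _ )^-1; move: N.+2%:R N2 => x x0.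
by field; rewrite x0 expf_neq0 ?pnatr_eq0.
Qed.

(** Large enough for the two base cases of the next bound, 2 standing for sqrt 2. *)
Definition geg_cst : R := geg_weight 1 0 + 2 * geg_weight 2 0.

Lemma geg_cst_ge0 : 0 <= geg_cst. Proof. by apply: addr_ge0; [|apply: mulr_ge0 => //]; exact: geg_weight_ge0. Qed.

(** The left side decreases from N to N + 2, since N (N + 2) <= (N + 1)^2. *)
Lemma geg_weight0_bound N : (0 < N)%N -> geg_weight N 0 ^+ 2 * N%:R <= geg_cst ^+ 2.
Proof.
have h1 := geg_weight_ge0 1 0; have h2 := geg_weight_ge0 2 0.
case: N => // N _.
suff: geg_weight N.+1 0 ^+ 2 * N.+1%:R <= geg_cst ^+ 2 /\ geg_weight N.+2 0 ^+ 2 * N.+2%:R <= geg_cst ^+ 2 by case.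
elim: N => [|N [A B]]; split => //.
- rewrite mulr1 ler_sqr ?nnegrE ?geg_cst_ge0// /geg_cst; lra.
- apply: (@le_trans _ _ ((2 * geg_weight 2 0) ^+ 2)).
    by rewrite [(2 * _) ^+ 2]exprMn mulrC ler_wpM2r ?sqr_ge0// -natrX ler_nat.
  rewrite ler_sqr ?nnegrE ?geg_cst_ge0//; first by rewrite /geg_cst lerDr.
  exact: mulr_ge0.
- apply: le_trans A; have E := geg_weight0SS N.+1 isT.
  have n0 : 0 < N.+2%:R :> R by rewrite ltr0n.
  have n0' := ltr0n R N.+1.
  rewrite -(ler_pM2r (exprn_gt0 2 n0)).
  have -> : geg_weight N.+3 0 ^+ 2 * N.+3%:R * N.+2%:R ^+ 2 = (geg_weight N.+3 0 * N.+2%:R) ^+ 2 * N.+3%:R by ring.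
  have -> : geg_weight N.+1 0 ^+ 2 * N.+1%:R * N.+2%:R ^+ 2 = geg_weight N.+1 0 ^+ 2 * (N.+1%:R * N.+2%:R ^+ 2).
    by rewrite mulrA.
  rewrite E.
  have -> : (geg_weight N.+1 0 * N.+1%:R) ^+ 2 * N.+3%:R = geg_weight N.+1 0 ^+ 2 * (N.+1%:R ^+ 2 * N.+3%:R).
    by ring.
  apply: ler_wpM2l; first exact: sqr_ge0.
  have -> : N.+3%:R = N.+1%:R + 2 :> R by rewrite -(addn2 N.+1) natrD.
  have -> : N.+2%:R = N.+1%:R + 1 :> R by rewrite natr1.
  by have : 0 <= N.+1%:R :> R by []; move: N.+1%:R => x; nra.
Qed.

Let rho N n := geg_weight N n * (geg R N n).[0] ^+ 2.

Let rho_ge0 N n : 0 <= rho N n.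
Proof. by rewrite mulr_ge0 ?geg_weight_ge0 ?sqr_ge0. Qed.

Let geg0S N n : (0 < N)%N ->
  (N + n)%:R * (geg R N n.+1).[0] = - (n%:R * (geg R N n.-1).[0]).
Proof. by move=> N0; rewrite geg_recE// mulr0 mul0r sub0r. Qed.

Let rho1 N : (0 < N)%N -> rho N 1 = 0.
Proof.
move=> N0; have := geg0S N 0 N0; rewrite mul0r oppr0 => /eqP.
by rewrite mulf_eq0 (negPf (natr_add_neq0 R N 0 N0)) => /eqP e; rewrite /rho e expr0n mulr0.
Qed.

Let rhoSS N n : (0 < N)%N ->
  rho N n.+2 * (n.+2%:R * (N + n.+1)%:R) = rho N n * (n.+1%:R * (N + n)%:R).
Proof.
move=> N0; have E := geg0S N n.+1 N0; rewrite /= in E.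
have k1 := geg_weightS N n.+1 N0; have k2 := geg_weightS N n N0.
have z0 := natr_add_neq0 R N n.+1 N0.
have n1 : n.+1%:R != 0 :> R by rewrite pnatr_eq0.
have {}E : (geg R N n.+2).[0] = - (n.+1%:R * (geg R N n).[0]) / (N + n.+1)%:R.
  by rewrite -E mulrAC divff// mul1r.
have {}k2 : geg_weight N n.+1 = geg_weight N n * (N + n)%:R / n.+1%:R by rewrite -k2 mulfK.
rewrite /rho E.
have -> : geg_weight N n.+2 * (- (n.+1%:R * (geg R N n).[0]) / (N + n.+1)%:R) ^+ 2 * (n.+2%:R * (N + n.+1)%:R)
   = (geg_weight N n.+2 * n.+2%:R) * (n.+1%:R * (geg R N n).[0]) ^+ 2 / (N + n.+1)%:R.
  by move: (N + n.+1)%:R z0 n.+1%:R n1 => a a0 b b0; field.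
rewrite k1 k2; move: (N + n.+1)%:R z0 n.+1%:R n1 => a a0 b b0.
by field; rewrite ?a0 ?b0.
Qed.

(** [rho] vanishes for n = 1. From n to n + 2 the left side does not increase, because a (a + 2) <=
    (a + 1)^2 for a = n + 1 and for a = N + n. *)
Lemma rho_bound N n : (0 < N)%N ->
  rho N n ^+ 2 * (n.+1%:R * (N + n)%:R) <= geg_cst ^+ 2.
Proof.
move=> N0.
suff: rho N n ^+ 2 * (n.+1%:R * (N + n)%:R) <= geg_cst ^+ 2 /\
  rho N n.+1 ^+ 2 * (n.+2%:R * (N + n.+1)%:R) <= geg_cst ^+ 2 by case.
elim: n => [|n [A B]]; split => //.
- by rewrite /rho geg0 -polyC1 hornerC expr1n mulr1 mul1r addn0 geg_weight0_bound.
- by rewrite rho1// expr0n mul0r sqr_ge0.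
- apply: le_trans A.
  have E := rhoSS N n N0.
  have n0 : 0 < n.+2%:R * (N + n.+1)%:R :> R by rewrite mulr_gt0 ?ltr0n// addnS.
  rewrite -(ler_pM2r (exprn_gt0 2 n0)).
  have -> : rho N n.+2 ^+ 2 * (n.+3%:R * (N + n.+2)%:R) * (n.+2%:R * (N + n.+1)%:R) ^+ 2 =
    (rho N n.+2 * (n.+2%:R * (N + n.+1)%:R)) ^+ 2 * (n.+3%:R * (N + n.+2)%:R) by ring.
  rewrite E.
  have -> : (rho N n * (n.+1%:R * (N + n)%:R)) ^+ 2 * (n.+3%:R * (N + n.+2)%:R) =
    rho N n ^+ 2 * ((n.+1%:R * (N + n)%:R) ^+ 2 * (n.+3%:R * (N + n.+2)%:R)) by ring.
  have -> : rho N n ^+ 2 * (n.+1%:R * (N + n)%:R) * (n.+2%:R * (N + n.+1)%:R) ^+ 2 =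
    rho N n ^+ 2 * (n.+1%:R * ((N + n)%:R * (n.+2%:R * (N + n.+1)%:R) ^+ 2)) by rewrite -!mulrA.
  apply: ler_wpM2l; first exact: sqr_ge0.
  have -> : n.+3%:R = n.+1%:R + 2 :> R by rewrite -(addn2 n.+1) natrD.
  have -> : n.+2%:R = n.+1%:R + 1 :> R by rewrite natr1.
  have -> : (N + n.+2)%:R = (N + n)%:R + 2 :> R by rewrite -natrD; congr _%:R; lia.
  have -> : (N + n.+1)%:R = (N + n)%:R + 1 :> R by rewrite natr1 addnS.
  have a0 : 0 <= n.+1%:R :> R by [].
  have b0 : 0 <= (N + n)%:R :> R by [].
  move: n.+1%:R (N + n)%:R a0 b0 => a b a0 b0.
  have -> : (a * b) ^+ 2 * ((a + 2) * (b + 2)) = (a * b) * ((a * (a + 2)) * (b * (b + 2))) by ring.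
  have -> : a * (b * ((a + 1) * (b + 1)) ^+ 2) = (a * b) * ((a + 1) ^+ 2 * (b + 1) ^+ 2) by ring.
  apply: ler_wpM2l; first exact: mulr_ge0.
  by apply: ler_pM; nra.
Qed.

Lemma rho_le N n (c : R) : (0 < N)%N -> 0 <= c -> c ^+ 2 <= n.+1%:R * (N + n)%:R ->
  rho N n * c <= geg_cst.
Proof.
move=> N0 c0 cE; have r0 : 0 <= rho N n * c by rewrite mulr_ge0.
rewrite -ler_sqr ?nnegrE ?geg_cst_ge0//.
have -> : (rho N n * c) ^+ 2 = rho N n ^+ 2 * c ^+ 2 by ring.
by apply: le_trans (rho_bound N n N0); rewrite ler_wpM2l ?sqr_ge0.
Qed.

Lemma is_derive_geg_cos N n (t : R) :
  is_derive t 1 (fun t => (geg R N n).[cos t]) (- sin t * (geg R N n)^`().[cos t]).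
Proof.
apply: (is_derive_pt_eq (is_derive1_comp (f := horner (geg R N n)) (g := @cos R)
  (is_derive_poly _ _) (is_derive_cos t))).
by rewrite mulrC.
Qed.

Section ge2.
Variables (N' n : nat).
Let N := N'.+2.
Let k := geg_weight N n.
Let mu : R := n%:R + N%:R / 2.
Let B : R := N%:R * (N%:R - 2) / 4.
Let Y (t : R) : R := (geg R N n).[cos t].
Let Z (t : R) : R := (geg R N n.-1).[cos t].
(** For u = sqrt k sin^(N/2) Y one finds u' = sqrt k sin^(N/2 - 1) g, which explains the exponents
    in U, P and V. *)
Let g (t : R) : R := mu * cos t * Y t - n%:R * Z t.
Let g' (t : R) : R := mu * (- sin t * Y t + cos t * (- sin t * (geg R N n)^`().[cos t]))
   - n%:R * (- sin t * (geg R N n.-1)^`().[cos t]).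
Let U (t : R) : R := k * sin t ^+ N * Y t ^+ 2.
Let P (t : R) : R := k * sin t ^+ N'.+1 * (Y t * g t).
Let V (t : R) : R := k * sin t ^+ N' * g t ^+ 2.

Let dg (t : R) : is_derive t 1 g (g' t).
Proof.
apply: (is_derive_pt_eq (f := g) (is_derive_ptD
  (is_derive_ptM (is_derive_ptM (is_derive_cst mu t 1) (is_derive_cos t)) (is_derive_geg_cos N n t))
  (is_derive_ptN (is_derive_ptM (is_derive_cst (n%:R : R) t 1) (is_derive_geg_cos N n.-1 t))))).
by rewrite /g' /Y /=; ring.
Qed.

Let dS j (t : R) : is_derive t 1 (fun t => k * sin t ^+ j) (k * (j%:R * sin t ^+ j.-1 * cos t)).
Proof.
apply: (is_derive_pt_eq (is_derive_ptM (is_derive_cst k t 1) (is_derive_ptX j (is_derive_sin t)))).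
by rewrite /=; ring.
Qed.

Let dY (t : R) : 0 < t < pi ->
  - sin t * (geg R N n)^`().[cos t] = - (n%:R * (Z t - cos t * Y t) / sin t).
Proof.
move=> /sin_gt0_pi s0; have [h _] := geg_deriv_pair R N n (cos t) isT.
rewrite -sin2cos2 in h; rewrite -h.
by field; rewrite gt_eqF.
Qed.

Let dg' (t : R) : 0 < t < pi ->
  g' t = - ((N%:R - 2) / 2 * (cos t / sin t) * g t) - (mu ^+ 2 * sin t ^+ 2 - B) / sin t * Y t.
Proof.
move=> ht; have s0 := sin_gt0_pi ht; have s0' : sin t != 0 by rewrite gt_eqF.
have [_] := geg_deriv_pair R N n (cos t) isT; rewrite -sin2cos2 -/(Z t) -/(Y t) => h.
rewrite /g' dY//.
have -> : n%:R * (- sin t * (geg R N n.-1)^`().[cos t]) =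
   - (n%:R * (n%:R + N%:R - 1) * (cos t * Z t - Y t) / sin t).
  by rewrite -h; field.
rewrite /g /mu /B.
have c2 := cos2sin2 t.
by field: c2.
Qed.

Let NmuB : mu ^+ 2 - B = n%:R ^+ 2 + n%:R * N%:R + N%:R / 2.
Proof. by rewrite /mu /B; field. Qed.

Let N2 : 2 <= N%:R :> R. Proof. by rewrite ler_nat. Qed.

Let n_ge0 : 0 <= n%:R :> R. Proof. by []. Qed.

Let n_le_sq : (n%:R : R) <= n%:R ^+ 2.
Proof. by rewrite -natrX ler_nat; case: n => // m; rewrite expnS leq_pmulr. Qed.

Let mu1 : 1 <= mu.
Proof. by rewrite /mu; have := N2; have := n_ge0; lra. Qed.

Let muB : mu <= mu ^+ 2 - B.
Proof.
rewrite NmuB /mu; have := n_le_sq; have : 0 <= n%:R * N%:R :> R by rewrite mulr_ge0.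
lra.
Qed.

Let k0 : 0 <= k. Proof. exact: geg_weight_ge0. Qed.

Let dU (t : R) : 0 < t < pi -> is_derive t 1 U (2 * P t).
Proof.
move=> ht; have s0' : sin t != 0 by rewrite gt_eqF// sin_gt0_pi.
apply: (is_derive_pt_eq (f := U) (is_derive_ptM (dS N t) (is_derive_ptX 2 (is_derive_geg_cos N n t)))).
rewrite dY// -/(Y t) /P /g /mu /= expr1 !exprS /N; field.
exact: s0'.
Qed.

Let dP0 (t : R) : is_derive t 1 P
  (k * (N'.+1%:R * sin t ^+ N' * cos t) * (Y t * g t) +
   k * sin t ^+ N'.+1 * ((- sin t * (geg R N n)^`().[cos t]) * g t + Y t * g' t)).
Proof.
exact: (is_derive_ptM (dS N'.+1 t) (is_derive_ptM (is_derive_geg_cos N n t) (dg t))).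
Qed.

Let q (t : R) : R := mu ^+ 2 - B / sin t ^+ 2.

Let dP (t : R) : 0 < t < pi -> is_derive t 1 P (V t - q t * U t).
Proof.
move=> ht; have s0' : sin t != 0 by rewrite gt_eqF// sin_gt0_pi.
apply: (is_derive_pt_eq (f := P) (dP0 t)).
have e : n%:R * (Z t - cos t * Y t) = mu * cos t * Y t - g t - n%:R * (cos t * Y t).
  by rewrite /g; ring.
have eU : U t = k * (sin t * (sin t * sin t ^+ N')) * Y t ^+ 2 by rewrite /U /N 2!exprS.
rewrite dY// dg'// e /V /q eU exprS /=.
have e2 : N'.+1%:R = N%:R - 1 :> R by rewrite /N -[N'.+2%:R]natr1 addrK.
have e3 : mu = n%:R + N%:R / 2 by [].
rewrite e2; move: (g t) (Y t) B (N%:R : R) mu e3 {e e2} => g1 y1 B1 N1 mu' e3.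
by rewrite e3; field.
Qed.

Let dV (t : R) : 0 < t < pi -> is_derive t 1 V (- (2 * q t * P t)).
Proof.
move=> ht; have s0' : sin t != 0 by rewrite gt_eqF// sin_gt0_pi.
apply: (is_derive_pt_eq (f := V) (is_derive_ptM (dS N' t) (is_derive_ptX 2 (dg t)))).
rewrite dg'//.
have -> : N'%:R * sin t ^+ N'.-1 = (N%:R - 2) * (sin t ^+ N' / sin t).
  rewrite /N; case: N' => [|N'']; first by rewrite subrr !mul0r.
  by rewrite /= exprS -(addn2 N''.+1) natrD addrK; field.
rewrite /P /q !exprS /=.
by field; rewrite s0'.
Qed.

Let P00 : P 0 = 0.
Proof. by rewrite /P sin0 expr0n mulr0 mul0r. Qed.

Let cP : continuous P.
Proof.
move=> t; have [d _] := dP0 t; apply/differentiable_continuous.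
exact/derivable1_diffP.
Qed.

(** At the equator U is rho_n and, for n > 0, V is n (N + n - 1) rho_(n-1). As mu^2 - B = n^2 + n N
    + N/2 lies between n (N + n - 1) and (n + 1)(N + n), [rho_le] bounds both terms. *)
Let GA : V (pi / 2) + (mu ^+ 2 - B) * U (pi / 2) <= 2 * geg_cst * Num.sqrt (mu ^+ 2 - B).
Proof.
have mB0 : 0 <= mu ^+ 2 - B by apply: le_trans muB; apply: le_trans mu1.
set W := mu ^+ 2 - B in mB0 *.
have UE : U (pi / 2) = rho N n.
  by rewrite /U /Y sin_pihalf cos_pihalf expr1n mulr1.
have h1 : W * U (pi / 2) <= geg_cst * Num.sqrt W.
  rewrite UE -{1}(sqr_sqrtr mB0).
  have -> : Num.sqrt W ^+ 2 * rho N n = rho N n * Num.sqrt W * Num.sqrt W by ring.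
  apply: ler_wpM2r; first exact: sqrtr_ge0.
  apply: rho_le => //; rewrite ?sqrtr_ge0// sqr_sqrtr// /W NmuB.
  have -> : n.+1%:R * (N + n)%:R = n%:R ^+ 2 + n%:R * N%:R + N%:R + n%:R :> R.
    by rewrite -[n.+1%:R]natr1 natrD; ring.
  by have := n_ge0; have := N2; lra.
suff h2 : V (pi / 2) <= geg_cst * Num.sqrt W.
  have -> : 2 * geg_cst * Num.sqrt W = geg_cst * Num.sqrt W + geg_cst * Num.sqrt W by ring.
  exact: lerD.
rewrite /V sin_pihalf expr1n mulr1 /g cos_pihalf mulr0 mul0r sub0r sqrrN /Z.
have [n0|n0] := posnP n.
  by rewrite n0 mul0r expr0n mulr0 mulr_ge0 ?geg_cst_ge0 ?sqrtr_ge0.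
have nn : n = n.-1.+1 by rewrite prednK.
have kE : k * n%:R = geg_weight N n.-1 * (N + n.-1)%:R.
  by rewrite /k {1 2}nn geg_weightS.
have -> : k * (n%:R * (geg R N n.-1).[cos (pi / 2)]) ^+ 2 =
   (k * n%:R) * (n%:R * (geg R N n.-1).[0] ^+ 2) by rewrite cos_pihalf; ring.
rewrite kE.
pose c : R := n%:R * (N + n.-1)%:R.
have c0 : 0 <= c by rewrite mulr_ge0.
have -> : geg_weight N n.-1 * (N + n.-1)%:R * (n%:R * (geg R N n.-1).[0] ^+ 2) =
   rho N n.-1 * Num.sqrt c * Num.sqrt c.
  have -> : rho N n.-1 * Num.sqrt c * Num.sqrt c = rho N n.-1 * Num.sqrt c ^+ 2 by ring.
  by rewrite sqr_sqrtr// /rho /c; ring.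
have rc : 0 <= rho N n.-1 * Num.sqrt c by rewrite mulr_ge0 ?sqrtr_ge0.
apply: ler_pM => //.
  by apply: rho_le => //; rewrite ?sqrtr_ge0// sqr_sqrtr// -nn.
apply: ler_wsqrtr; rewrite /W NmuB /c natrD.
have -> : n.-1%:R = n%:R - 1 :> R by rewrite {2}nn -[n.-1.+1%:R]natr1 addrK.
have -> : n%:R * (N%:R + (n%:R - 1)) = n%:R ^+ 2 + n%:R * N%:R - n%:R :> R by ring.
by have := N2; have := n_ge0; lra.
Qed.

Lemma geg_bound_half (th : R) : 0 < th <= pi / 2 ->
  geg_weight N n * sin th ^+ N * (geg R N n).[cos th] ^+ 2 <=
    80 * geg_cst / (sin th * Num.sqrt mu).
Proof.
move=> hth.
have B0 : 0 <= B.
  by rewrite /B divr_ge0// mulr_ge0// subr_ge0.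
have s0 t j : 0 < t < pi -> 0 <= sin t ^+ j by move=> h; rewrite exprn_ge0// ltW// sin_gt0_pi.
have := @oscillator_bound R B mu (2 * geg_cst) U P V B0 mu1 muB dU dP dV _ _ _ P00 cP GA th hth.
rewrite mulrA -natrM; apply.
- by move=> t ht; rewrite mulr_ge0 ?sqr_ge0// mulr_ge0// s0.
- by move=> t ht; rewrite mulr_ge0 ?sqr_ge0// mulr_ge0// s0.
- by move=> t ht; rewrite /P /U /V /N !exprS expr0; ring.
Qed.

End ge2.

Let geg_weight_1 n : geg_weight 1 n = geg_weight 1 0.
Proof.
elim: n => // n IH; have := geg_weightS 1 n isT; rewrite add1n IH.
by apply: mulIf; rewrite pnatr_eq0.
Qed.

(* B < 0 when N = 1, which breaks the monotonicity used above; here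
   (1 - x^2) ((1 - x^2) y'^2 + n (n + 1) y^2) is nonincreasing in x = cos t. *)
Let legendre_bound n (th : R) : 0 < th <= pi / 2 ->
  geg_weight 1 n * sin th ^+ 1 * (geg R 1 n).[cos th] ^+ 2 <=
    80 * geg_cst / (sin th * Num.sqrt (n%:R + 1 / 2)).
Proof.
move=> /andP[th0 thp].
have s0 : 0 < sin th by apply: sin_gt0_pi; rewrite th0/=; have := pi_gt0 R; lra.
have x0 : 0 <= cos th by apply: cos_ge0_pihalf; rewrite thp andbT; lra.
have x1 : cos th < 1.
  rewrite lt_def cos_le1 andbT eq_sym; apply/negP => /eqP c1.
  by have := sin2cos2 th; rewrite c1 expr1n subrr => /eqP; rewrite sqrf_eq0 gt_eqF.
pose Y (t : R) : R := (geg R 1 n).[t]; pose Z (t : R) : R := (geg R 1 n.-1).[t].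
(* (1 - t^2) y' is written n (Z - t Y), which makes [Q] polynomial; Q' = - 2 t n (n + 1) Y^2. *)
pose Q (t : R) : R := n%:R ^+ 2 * (Z t - t * Y t) ^+ 2 + n%:R * (n%:R + 1) * ((1 - t ^+ 2) * Y t ^+ 2).
have n0 : 0 <= n%:R :> R by [].
have Qle : Q (cos th) <= Q 0.
  rewrite -lerN2.
  apply: (@nondecreasing_of_derive_cc R (fun t => - Q t)
    (fun t => 2 * t * (n%:R * (n%:R + 1)) * Y t ^+ 2)) => // t /andP[h1 h2].
    have t1 : 1 - t ^+ 2 != 0.
      rewrite gt_eqF// subr_gt0 expr_lt1//; exact: le_lt_trans x1.
    have dy := is_derive_poly (geg R 1 n) t; have dz := is_derive_poly (geg R 1 n.-1) t.
    have di := is_derive_id t 1.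
    apply: (is_derive_pt_eq (is_derive_ptN (is_derive_ptD
      (is_derive_ptM (is_derive_cst (n%:R ^+ 2 : R) t 1) (is_derive_ptX 2
        (is_derive_ptD dz (is_derive_ptN (is_derive_ptM di dy)))))
      (is_derive_ptM (is_derive_cst (n%:R * (n%:R + 1) : R) t 1)
        (is_derive_ptM (is_derive_ptD (is_derive_cst (1 : R) t 1) (is_derive_ptN (is_derive_ptX 2 di)))
           (is_derive_ptX 2 dy)))))).
    have [A B] := geg_deriv_pair R 1 n t isT.
    rewrite -/(Y t) -/(Z t) in A B *.
    have {}A : (geg R 1 n)^`().[t] = n%:R * (Z t - t * Y t) / (1 - t ^+ 2).
      by rewrite -A mulrAC divff// mul1r.
    have {}B : n%:R * (geg R 1 n.-1)^`().[t] = n%:R * (n%:R + 1 - 1) * (t * Z t - Y t) / (1 - t ^+ 2).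
      by rewrite -B; field.
    move: A B; move: ((geg R 1 n)^`().[t]) ((geg R 1 n.-1)^`().[t]) => y' z' A B.
    rewrite /= /Q !expr1.
    have -> : n%:R ^+ 2 * (2 * (Z t - t * Y t) * (z' - (1 * Y t + t * y'))) =
      2 * n%:R * (Z t - t * Y t) * (n%:R * z' - n%:R * (Y t + t * y')) by ring.
    by rewrite B A; field.
  by rewrite mulr_ge0 ?sqr_ge0// mulr_ge0 ?mulr_ge0 ?addr_ge0// ltW.
have C0 := geg_cst_ge0.
have k0 := geg_weight_ge0 1 n.
have r1 : rho 1 n * (n%:R + 1) <= geg_cst.
  by apply: rho_le; rewrite ?addr_ge0// add1n natr1 expr2.
have r2 : rho 1 n.-1 * n%:R <= geg_cst.
  case: (n) => [|n']; first by rewrite mulr0.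
  by apply: rho_le; rewrite // add1n expr2.
have main : geg_weight 1 n * sin th ^+ 2 * Y (cos th) ^+ 2 * (n%:R + 1) <= 2 * geg_cst.
  have [nz|npos] := posnP n.
    rewrite nz add0r mulr1 /Y nz geg0 -polyC1 hornerC expr1n mulr1.
    apply: (@le_trans _ _ (geg_weight 1 0 * 1)).
      by apply: ler_wpM2l; [exact: geg_weight_ge0|rewrite exprn_ile1 ?sin_le1// ltW].
    have := geg_weight_ge0 2 0; have := geg_weight_ge0 1 0; rewrite /geg_cst; lra.
  have n1 : 0 < n%:R :> R by rewrite ltr0n.
  rewrite -(ler_pM2r n1).
  apply: (@le_trans _ _ (geg_weight 1 n * Q (cos th))).
    have -> : geg_weight 1 n * sin th ^+ 2 * Y (cos th) ^+ 2 * (n%:R + 1) * n%:R =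
       geg_weight 1 n * (n%:R * (n%:R + 1) * ((1 - cos th ^+ 2) * Y (cos th) ^+ 2)).
      by rewrite -sin2cos2; ring.
    by apply: ler_wpM2l => //; rewrite /Q lerDr mulr_ge0 ?sqr_ge0.
  apply: (@le_trans _ _ (geg_weight 1 n * Q 0)); first exact: ler_wpM2l.
  have -> : geg_weight 1 n * Q 0 = n%:R * (rho 1 n.-1 * n%:R) + n%:R * (rho 1 n * (n%:R + 1)).
    by rewrite /rho (geg_weight_1 n.-1) -(geg_weight_1 n) /Q /Y /Z; ring.
  have := ler_wpM2l n0 r1; have := ler_wpM2l n0 r2; lra.
have m0 : 0 < n%:R + 1 / 2 :> R by rewrite ltr_wpDl.
have sm0 : 0 < Num.sqrt (n%:R + 1 / 2 : R) by rewrite sqrtr_gt0.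
have sm1 : Num.sqrt (n%:R + 1 / 2) <= n%:R + 1 :> R.
  have n10 : 0 <= n%:R + 1 :> R by rewrite addr_ge0.
  rewrite -[leRHS]ger0_norm// -sqrtr_sqr; apply: ler_wsqrtr.
  by have := sqr_ge0 (n%:R : R); rewrite sqrrD1; lra.
rewrite expr1 ler_pdivlMr ?mulr_gt0//.
have -> : geg_weight 1 n * sin th * (geg R 1 n).[cos th] ^+ 2 * (sin th * Num.sqrt (n%:R + 1 / 2)) =
   geg_weight 1 n * sin th ^+ 2 * Y (cos th) ^+ 2 * Num.sqrt (n%:R + 1 / 2) by rewrite /Y; ring.
apply: (@le_trans _ _ (2 * geg_cst)); last lra.
apply: le_trans main; apply: ler_wpM2l => //.
by rewrite mulr_ge0 ?sqr_ge0// mulr_ge0 ?sqr_ge0.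
Qed.

Lemma geg_bound N n (th : R) : (0 < N)%N -> 0 < th < pi ->
  geg_weight N n * sin th ^+ N * (geg R N n).[cos th] ^+ 2 <=
    80 * geg_cst / (sin th * Num.sqrt (n%:R + N%:R / 2)).
Proof.
(* The reflection t -> pi - t preserves sin and changes [geg] by a sign at most. *)
move=> N0; wlog thp : th / th <= pi / 2 => [W|] hth.
  have [/W|thp] := leP th (pi / 2); first exact.
  have := W (pi - th).
  have -> : cos (pi - th) = - cos th by rewrite cosB cospi sinpi; ring.
  have -> : sin (pi - th) = sin th by rewrite sinB cospi sinpi; ring.
  rewrite geg_opp// exprMn sqrr_sign mul1r; apply; first lra.
  by apply/andP; split; lra.
have hth' : 0 < th <= pi / 2 by case/andP: hth => -> _.
case: N N0 => [//|[|N']] _; first exact: legendre_bound.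
exact: geg_bound_half.
Qed.

End gegenbauer_bound.

(** * Closed form of the polar factors *)

Section polar_factors.
Variable R : realType.

Definition polar_norm (i : nat) : R :=
  Num.sqrt (pi * Gamma (i%:R / 2) / Gamma ((i%:R + 1) / 2)).

Let f0 k : k`!%:R != 0 :> R. Proof. by rewrite pnatr_eq0 -lt0n fact_gt0. Qed.

Section half_angle.
Variable t : R.
Hypothesis ht : 0 < t < pi.

Let s0 : 0 < sin t. Proof. exact: sin_gt0_pi. Qed.

Let x1 : -1 < cos t < 1.
Proof.
have s2 : 0 < sin t ^+ 2 by rewrite exprn_gt0.
have h : cos t ^+ 2 < 1 by rewrite cos2sin2; lra.
by rewrite -ltr_norml -(expr_lt1 (n := 2))// real_normK ?num_real.
Qed.

(** [p] and [r] are cos (t/2) and sin (t/2). *)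
Let p : R := Num.sqrt ((1 + cos t) / 2).
Let r : R := Num.sqrt ((1 - cos t) / 2).

Let p0 : 0 < p. Proof. rewrite sqrtr_gt0; have := x1; lra. Qed.
Let r0 : 0 < r. Proof. rewrite sqrtr_gt0; have := x1; lra. Qed.
Let p2 : p ^+ 2 = (1 + cos t) / 2.
Proof. rewrite sqr_sqrtr//; have := x1; lra. Qed.
Let r2 : r ^+ 2 = (1 - cos t) / 2.
Proof. rewrite sqr_sqrtr//; have := x1; lra. Qed.

Let prE : p * r = sin t / 2.
Proof.
apply/eqP; rewrite -(eqrXn2 (n := 2))// ?mulr_ge0 ?divr_ge0 ?(ltW p0) ?(ltW r0) ?(ltW s0)//.
by rewrite exprMn p2 r2 expr_div_n sin2cos2; apply/eqP; field.
Qed.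

Let quotE : (1 + cos t) / (1 - cos t) = (p / r) `^ 2%:R.
Proof.
rewrite powR_mulrn ?divr_ge0 ?(ltW p0) ?(ltW r0)// expr_div_n p2 r2; field.
by have := x1; move=> /andP[_ h]; rewrite gt_eqF// subr_gt0.
Qed.

(** With m = (N - 1)/2 this is (p / r)^(-m) p^(2m) = (p r)^m. *)
Lemma half_angle_pos (N : nat) :
  ((1 + cos t) / (1 - cos t)) `^ (- ((N%:R - 1) / 2) / 2) *
  (Num.sqrt (1 - (1 - cos t) / 2) ^+ N / Num.sqrt (1 - (1 - cos t) / 2)) =
  (sin t / 2) `^ ((N%:R - 1) / 2).
Proof.
have -> : 1 - (1 - cos t) / 2 = (1 + cos t) / 2 by field.
rewrite -/p quotE -powRrM; set m := (N%:R - 1) / 2.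
have -> : 2 * (- m / 2) = - m by field.
have -> : p ^+ N / p = p `^ (m + m).
  have -> : m + m = N%:R - 1 by rewrite /m; field.
  rewrite powRB ?powRr1 ?powR_mulrn ?(ltW p0)//.
  by rewrite (gt_eqF p0) implybT.
have rV0 : 0 <= r^-1 by rewrite invr_ge0 ltW.
rewrite -prE (powRM _ (ltW p0) rV0) (powRM _ (ltW p0) (ltW r0)) powRD ?(gt_eqF p0) ?implybT//.
rewrite -[r^-1]powR_inv1 ?(ltW r0)// -powRrM mulN1r opprK powRN.
have pm : p `^ m != 0 by rewrite gt_eqF// powR_gt0.
by field.
Qed.

Lemma half_angle_neg (M : nat) :
  ((1 + cos t) / (1 - cos t)) `^ (M%:R / 2) * ((1 - cos t) / 2) ^+ M = (sin t / 2) ^+ M.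
Proof.
have e : 2 * (M%:R / 2) = M%:R :> R by field.
rewrite quotE -powRrM e.
rewrite powR_mulrn ?divr_ge0 ?(ltW p0) ?(ltW r0)// -r2 -prE -exprMn; congr (_ ^+ _).
by field; rewrite gt_eqF.
Qed.

End half_angle.

(** As m = M + (i - 2)/2, the prefactor in sin leaves sin^M 2^(-m) of (sin t / 2)^m. D is recorded
    through its square, where the root in [Pconst] disappears and [geg_weight] comes out. *)
Lemma Ptilde_in_nonneg (i M n : nat) : (2 <= i)%N ->
  let N := (2 * M + i).-1 in
  exists2 D : R, D ^+ 2 = polar_norm i ^+ 2 * ((n%:R + N%:R / 2) * geg_weight R N n) &
  forall t, 0 < t < pi ->
    Ptilde_in i (M + n)%:Z M%:Z t = D * sin t ^+ M * (geg R N n).[cos t].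
Proof.
move=> i2 N.
have N0 : (0 < N)%N by rewrite /N; lia.
have NE : N%:R = 2 * M%:R + i%:R - 1 :> R.
  have -> : N = (2 * M + i - 1)%N by rewrite /N subn1.
  by rewrite natrB; [rewrite natrD natrM|lia].
pose m : R := (N%:R - 1) / 2.
pose a : R := (i%:R - 2) / 2.
have mE : m = M%:R + a by rewrite /m NE /a; field.
have PE : Pconst R i (M + n)%:Z M%:Z ^+ 2 = (n%:R + N%:R / 2) * ((N + n).-1`!%:R / n`!%:R).
  rewrite /Pconst.
  have -> : absz ((M + n)%:Z + M%:Z + i%:Z - 2)%R = (N + n).-1 by rewrite /N; lia.
  have -> : absz ((M + n)%:Z - M%:Z)%R = n by lia.
  have E : (2 * ((M + n)%:Z)%:~R + i%:R - 1) / 2 = n%:R + N%:R / 2 :> R.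
    by rewrite NE -pmulrn natrD; field.
  rewrite sqr_sqrtr E// mulr_ge0 ?divr_ge0// addr_ge0// divr_ge0//.
exists (polar_norm i * Pconst R i (M + n)%:Z M%:Z * 2 `^ (- m) / Gamma (1 + m)).
  have -> : Gamma (1 + m) = Gamma (N.+1%:R / 2).
    by congr Gamma; rewrite -natr1 /m; field.
  rewrite !exprMn PE /geg_weight; set d := (Gamma _)^-1.
  have -> : (2 `^ (- m)) ^+ 2 = (2 ^+ N.-1)^-1 :> R.
    rewrite -powR_mulrn ?powR_ge0// -powRrM.
    have -> : - m * 2%:R = - N.-1%:R.
      have -> : N.-1%:R = N%:R - 1 :> R by rewrite -[in RHS](prednK N0) -[N.-1.+1%:R]natr1 addrK.
      by rewrite /m; field.
    by rewrite powRN powR_mulrn.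
  by field; rewrite f0 expf_neq0 ?pnatr_eq0.
move=> t ht; rewrite /Ptilde_in /ferrersP -/a -/(polar_norm i).
have -> : ((M + n)%:Z)%:~R + a = m + n%:R by rewrite mE -pmulrn natrD; ring.
have -> : (M%:Z)%:~R + a = m by rewrite mE -pmulrn.
rewrite opprK hypF_geg//; last first.
  have /andP[h1 h2] : -1 < cos t < 1.
    have s2 : 0 < sin t ^+ 2 by rewrite exprn_gt0// sin_gt0_pi.
    have h : cos t ^+ 2 < 1 by rewrite cos2sin2; lra.
    by rewrite -ltr_norml -(expr_lt1 (n := 2))// real_normK ?num_real.
  by apply/andP; split; lra.
have -> : 1 - 2 * ((1 - cos t) / 2) = cos t by field.
have s0 := sin_gt0_pi ht.
have := half_angle_pos t ht N; rewrite -/m.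
set A := _ `^ _; set B := Num.sqrt _ ^+ _ / _ => AB.
have hV : 0 <= 2^-1 :> R by rewrite invr_ge0.
have E : sin t `^ (- a) * (sin t / 2) `^ m = sin t ^+ M * 2 `^ (- m).
  rewrite (powRM _ (ltW s0) hV) mulrA -powRD; last by rewrite (gt_eqF s0) implybT.
  rewrite {1}mE addrCA addNr addr0 powR_mulrn ?(ltW s0)//.
  by rewrite -[2^-1]powR_inv1// -powRrM mulN1r.
rewrite (_ : _ * (A * _) = polar_norm i * Pconst R i (M + n)%:Z M%:Z *
   (sin t `^ (- a) * (A * B)) / Gamma (1 + m) * (geg R N n).[cos t]); last by ring.
by rewrite AB E; ring.
Qed.

(** The factorials in [Pconst] are swapped with respect to l = M; the factor (2M + n)! / n! of the
    series restores them, and its sign disappears in D^2. *)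
Lemma Ptilde_in_neg (M n : nat) : (0 < M)%N ->
  let N := (2 * M).+1 in
  exists2 D : R, D ^+ 2 = polar_norm 2 ^+ 2 * ((n%:R + N%:R / 2) * geg_weight R N n) &
  forall t, 0 < t < pi ->
    Ptilde_in 2 (M + n)%:Z (- M%:Z) t = D * (geg R N n).[cos t] * sin t ^+ M.
Proof.
move=> M0 N.
have NE : N%:R = 2 * M%:R + 1 :> R by rewrite -[N%:R]natr1 natrM.
have PE : Pconst R 2 (M + n)%:Z (- M%:Z) ^+ 2 = (n%:R + N%:R / 2) * (n`!%:R / (2 * M + n)`!%:R).
  rewrite /Pconst.
  have -> : absz ((M + n)%:Z + - M%:Z + 2 - 2)%R = n by lia.
  have -> : absz ((M + n)%:Z - - M%:Z)%R = (2 * M + n)%N by lia.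
  have E : (2 * ((M + n)%:Z)%:~R + 2%:R - 1) / 2 = n%:R + N%:R / 2 :> R.
    by rewrite NE -pmulrn natrD; field.
  rewrite sqr_sqrtr E// mulr_ge0 ?divr_ge0// addr_ge0// divr_ge0//.
exists (polar_norm 2 * Pconst R 2 (M + n)%:Z (- M%:Z) *
   ((-1) ^+ M / (n`!%:R * (M`!%:R * Gamma 1)) * (2 * M + n)`!%:R * 2^-1 ^+ M)).
  have -> : geg_weight R N n = (2 * M + n)`!%:R / (n`!%:R * 2 ^+ (2 * M)) * (M`!%:R * Gamma 1)^-1 ^+ 2.
    rewrite /geg_weight /=; congr (_ * _^-1 ^+ 2).
    rewrite -Gamma_natS; congr Gamma.
    by rewrite -[(2 * M).+2]addn2 natrD natrM -natr1; field.
  have e1 : ((-1) ^+ M) ^+ 2 = 1 :> R := sqrr_sign _ _.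
  have e2 : (2^-1 ^+ M) ^+ 2 = (2 ^+ (2 * M))^-1 :> R by rewrite -exprM mulnC exprVn.
  rewrite [(n`!%:R * (_ * _))^-1]invfM; set d := (M`!%:R * Gamma 1)^-1.
  have y0 : 2 ^+ (2 * M) != 0 :> R by rewrite expf_neq0// pnatr_eq0.
  rewrite !exprMn PE e1 e2; move: (2 ^+ (2 * M)) y0 => y y0.
  by field; rewrite !f0 y0.
move=> t ht; rewrite /Ptilde_in /ferrersP -/(polar_norm 2).
have s0 := sin_gt0_pi ht.
rewrite subrr mul0r oppr0 powRr0 mulr1 !addr0.
rewrite mulrNz opprK -!pmulrn natrD hypF_geg_neg//.
have -> : 1 - 2 * ((1 - cos t) / 2) = cos t by field.
have := half_angle_neg t ht M.
set A := _ `^ _; set z := (1 - cos t) / 2 => Az.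
rewrite (_ : _ * (A * _) = polar_norm 2 * Pconst R 2 (M + n)%:Z (- M%:Z) *
   ((-1) ^+ M / (n`!%:R * (M`!%:R * Gamma 1)) * (2 * M + n)`!%:R * (A * z ^+ M)) *
   (geg R N n).[cos t]); last by rewrite /N; ring.
by rewrite Az exprMn; ring.
Qed.

End polar_factors.

(** * Bounds for a single polar factor *)

Section polar_factor_bounds.
Variable R : realType.

(** The closed form is polynomial in sin and cos, hence continuous, and so gives the limits at 0 and
    pi. *)
Lemma PtildeE (i : nat) (L l : int) : (2 <= i)%N -> `|l| <= L -> 0 <= l \/ i = 2%N ->
  let N := (2 * absz l + i).-1 in let n := (absz L - absz l)%N in
  exists2 D : R, D ^+ 2 = polar_norm R i ^+ 2 * ((n%:R + N%:R / 2) * geg_weight R N n) &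
  forall t, 0 <= t <= pi ->
    Ptilde i L l t = D * sin t ^+ absz l * (geg R N n).[cos t].
Proof.
move=> i2 lL hl N n.
have [D DE inE] : exists2 D : R, D ^+ 2 = polar_norm R i ^+ 2 * ((n%:R + N%:R / 2) * geg_weight R N n) &
  forall t, 0 < t < pi -> Ptilde_in i L l t = D * sin t ^+ absz l * (geg R N n).[cos t].
  have LE : L = (absz l + n)%:Z by rewrite /n; lia.
  have [l0|l0] := leP 0 l.
    have [D DE h] := Ptilde_in_nonneg R i (absz l) n i2.
    exists D => [//|t ht]; have lE : (absz l)%:Z = l by lia.
    by have := h t ht; rewrite -LE lE.
  have i2' : i = 2%N by case: hl => // ?; lia.
  have al : (0 < absz l)%N by lia.
  have [D DE h] := Ptilde_in_neg R (absz l) n al.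
  have NE : N = (2 * absz l).+1 by rewrite /N i2'; lia.
  exists D => [|t ht]; first by rewrite NE i2'.
  have lE : - (absz l)%:Z = l by lia.
  by have := h t ht; rewrite -LE lE NE i2' mulrAC.
exists D => // t /andP[t0 tpi].
pose h (s : R) : R := D * sin s ^+ absz l * (geg R N n).[cos s].
have ch : continuous h.
  move=> s; have [d _] := is_derive_ptM (is_derive_ptM (is_derive_cst D s 1)
    (is_derive_ptX (absz l) (is_derive_sin s))) (is_derive_geg_cos R N n s).
  by apply/differentiable_continuous; exact/derivable1_diffP.
have pi0 := pi_gt0 R.
rewrite /Ptilde; case: eqVneq => [->|tN0].
  apply/cvg_lim => //; rewrite -/(h 0).
  have : h x @[x --> 0^'+] --> h 0 by apply: cvg_at_right_filter; exact: ch.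
  apply: cvg_trans; apply: near_eq_cvg; near=> s.
  by rewrite inE//; apply/andP; split; near: s; [exact: nbhs_right_gt|exact: nbhs_right_lt].
case: eqVneq => [->|tNpi].
  apply/cvg_lim => //; rewrite -/(h pi).
  have : h x @[x --> (pi : R)^'-] --> h pi by apply: cvg_at_left_filter; exact: ch.
  apply: cvg_trans; apply: near_eq_cvg; near=> s.
  by rewrite inE//; apply/andP; split; near: s; [exact: nbhs_left_gt|exact: nbhs_left_lt].
by rewrite inE// !lt_def t0 tN0 eq_sym tNpi.
Unshelve. all: end_near. Qed.

Lemma fact_add_le k n : ((k + n)`! <= n`! * (k.+1 * n.+1) ^ k)%N.
Proof.
elim: k => [|k IH]; first by rewrite expn0 muln1.
rewrite addSn factS expnS.
have h : ((k.+1 * n.+1) ^ k <= (k.+2 * n.+1) ^ k)%N by case: k {IH} => // k; rewrite leq_exp2r//; nia.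
have h2 : ((k + n).+1 <= k.+2 * n.+1)%N by nia.
rewrite mulnCA; apply: leq_mul => //; apply: leq_trans IH _.
by rewrite leq_mul2l h orbT.
Qed.

(** A crude growth rate in n, used at the poles with l = 0, where N = i - 1 does not depend on
    alpha. *)
Lemma geg_weight_le N n : (0 < N)%N ->
  geg_weight R N n <= (N ^ N.-1)%:R * (Gamma (N.+1%:R / 2))^-1 ^+ 2 * n.+1%:R ^+ N.-1.
Proof.
case: N => // k _; rewrite /geg_weight /=.
set g := _ ^+ 2; have g0 : 0 <= g by apply: sqr_ge0.
have n0 : 0 < n`!%:R :> R by rewrite ltr0n fact_gt0.
apply: (@le_trans _ _ ((k.+1 ^ k)%:R * n.+1%:R ^+ k * g)); last by rewrite mulrAC.
apply: ler_wpM2r => //; rewrite invfM mulrA.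
apply: (@le_trans _ _ ((k + n)`!%:R / n`!%:R)).
  rewrite ler_piMr ?divr_ge0// invf_le1 ?exprn_gt0//.
  by rewrite exprn_ege1// ler1n.
by rewrite ler_pdivrMr// -natrX -!natrM ler_nat mulnC -expnMn fact_add_le.
Qed.

Lemma Ptilde_interior (i : nat) (t : R) : (2 <= i)%N -> 0 < t < pi ->
  exists2 E : R, 0 <= E & forall L l : int, `|l| <= L -> 0 <= l \/ i = 2%N ->
    Ptilde i L l t ^+ 2 <= E * Num.sqrt (2 * L%:~R + i%:R - 1).
Proof.
move=> i2 ht; have s0 := sin_gt0_pi ht.
pose E := polar_norm R i ^+ 2 * (80 * geg_cst R / sin t) / sin t ^+ i.-1.
have E0 : 0 <= E.
  rewrite divr_ge0 ?exprn_ge0 ?(ltW s0)// mulr_ge0 ?sqr_ge0// divr_ge0 ?(ltW s0)//.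
  by rewrite mulr_ge0// geg_cst_ge0.
exists E => // L l lL hl.
have [D DE ->] := PtildeE i L l i2 lL hl; last by case/andP: ht => ? ?; rewrite !ltW.
set N := _.-1 in DE *; set n := (_ - _)%N in DE *.
have N0 : (0 < N)%N by rewrite /N; lia.
have muE : n%:R + N%:R / 2 = (2 * L%:~R + i%:R - 1) / 2 :> R.
  have -> : L%:~R = n%:R + `|l|%N%:R :> R.
    by rewrite -natrD pmulrn; congr _%:~R; rewrite /n; lia.
  have -> : N%:R = 2 * `|l|%N%:R + i%:R - 1 :> R.
    have -> : N = (2 * absz l + i - 1)%N by rewrite /N subn1.
    by rewrite natrB; [rewrite natrD natrM|lia].
  by field.
have mu0 : 0 < n%:R + N%:R / 2 :> R by rewrite ltr_wpDl// divr_gt0// ltr0n.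
have sm0 : 0 < Num.sqrt (n%:R + N%:R / 2) :> R by rewrite sqrtr_gt0.
have key := geg_bound R N n t N0 ht.
(* N = 2 |l| + i - 1, so sin^(2|l|) differs from the weight sin^N by a power that depends on i only
   and goes into E. *)
have sE : sin t ^+ absz l ^+ 2 = sin t ^+ N / sin t ^+ i.-1.
  have -> : N = (absz l * 2 + i.-1)%N by rewrite /N; lia.
  by rewrite exprD mulfK ?expf_neq0 ?gt_eqF// exprM.
rewrite !exprMn DE sE.
have -> : polar_norm R i ^+ 2 * ((n%:R + N%:R / 2) * geg_weight R N n) * (sin t ^+ N / sin t ^+ i.-1) *
   (geg R N n).[cos t] ^+ 2 = polar_norm R i ^+ 2 / sin t ^+ i.-1 * ((n%:R + N%:R / 2) *
     (geg_weight R N n * sin t ^+ N * (geg R N n).[cos t] ^+ 2)) by ring.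
have h1 : Num.sqrt (n%:R + N%:R / 2) <= Num.sqrt (2 * L%:~R + i%:R - 1) :> R.
  by rewrite ler_wsqrtr//; move: mu0; rewrite muE; lra.
apply: (@le_trans _ _ (E * Num.sqrt (n%:R + N%:R / 2))); last exact: ler_wpM2l.
have -> : E * Num.sqrt (n%:R + N%:R / 2) = polar_norm R i ^+ 2 / sin t ^+ i.-1 *
   ((80 * geg_cst R / sin t) * Num.sqrt (n%:R + N%:R / 2)) by rewrite /E; ring.
apply: ler_wpM2l; first by rewrite divr_ge0 ?sqr_ge0 ?exprn_ge0 ?(ltW s0).
apply: le_trans (ler_wpM2l (ltW mu0) key) _.
rewrite -{1}(sqr_sqrtr (ltW mu0)) le_eqVlt; apply/orP; left; apply/eqP; field.
by rewrite !gt_eqF.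
Qed.

(** sin^|l| vanishes for l <> 0. For l = 0 the polynomial is 1 or -1, and mu times the weight is
    O((L + 1) (L + 1)^(i-2)). *)
Lemma Ptilde_pole (i : nat) (t : R) : (2 <= i)%N -> t = 0 \/ t = pi ->
  exists2 E : R, 0 <= E & forall L l : int, `|l| <= L -> 0 <= l \/ i = 2%N ->
    (l != 0 -> Ptilde i L l t = 0) /\
    Ptilde i L 0 t ^+ 2 <= E * (absz L).+1%:R ^+ i.-1.
Proof.
move=> i2 ht; have st : sin t = 0 by case: ht => ->; rewrite ?sin0 ?sinpi.
have tpi : 0 <= t <= pi by case: ht => ->; rewrite lexx pi_ge0.
pose N := i.-1.
have N0 : (0 < N)%N by rewrite /N; lia.
pose c := (N ^ N.-1)%:R * (Gamma (N.+1%:R / 2) : R)^-1 ^+ 2.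
have c0 : 0 <= c by rewrite mulr_ge0 ?sqr_ge0.
pose E := polar_norm R i ^+ 2 * (N.+1%:R * c).
have E0 : 0 <= E by rewrite mulr_ge0 ?sqr_ge0// mulr_ge0.
exists E => // L l lL hl; split.
  have [D DE ->//] := PtildeE i L l i2 lL hl.
  move=> lN0; rewrite st expr0n absz_eq0 (negPf lN0) mulr0 mul0r//.
have L0 : 0 <= L by apply: le_trans lL.
have lL' : `|0%Z| <= L by rewrite normr0.
have [D DE ->//] := PtildeE i L 0 i2 lL' (or_introl (lexx _)).
rewrite absz0 muln0 add0n subn0 -/N expr0 mulr1 in DE *.
set n := absz L in DE *.
have g1 : (geg R N n).[cos t] ^+ 2 = 1.
  case: ht => ->; first by rewrite cos0 geg_1// expr1n.
  by rewrite cospi geg_opp// exprMn sqrr_sign geg_1// mul1r expr1n.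
rewrite exprMn g1 mulr1 DE /E -mulrA; apply: ler_wpM2l; first exact: sqr_ge0.
have -> : n.+1%:R ^+ i.-1 = n.+1%:R * n.+1%:R ^+ N.-1 :> R by rewrite -exprS prednK.
have -> : N.+1%:R * c * (n.+1%:R * n.+1%:R ^+ N.-1) = (N.+1%:R * n.+1%:R) * (c * n.+1%:R ^+ N.-1) by ring.
apply: ler_pM; rewrite ?geg_weight_ge0 ?geg_weight_le// ?addr_ge0 ?divr_ge0//.
rewrite -[N.+1%:R]natr1 -[n.+1%:R]natr1.
have : 0 <= n%:R :> R by []. have : 0 <= N%:R :> R by [].
by move: (n%:R : R) (N%:R : R) => x y x0 y0; nra.
Qed.

(** The first estimate is shaped to telescope over i: the power of |l| + 1 at i is that of |L| + 1
    at i - 1. The conditions on i and t stand after E, so that choice yields a total function. *)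
Lemma Ptilde_bounds (i : nat) (t : R) : exists E : R, (2 <= i)%N -> 0 <= t <= pi ->
  0 <= E /\ forall L l : int, `|l| <= L -> 0 <= l \/ i = 2%N ->
    Ptilde i L l t ^+ 2 * (absz l).+1%:R ^+ i.-2 <= E ^+ 2 * (absz L).+1%:R ^+ i.-1 /\
    (l != 0 -> `|Ptilde i L l t| <= E * (2 * L%:~R + i%:R - 1) `^ 4^-1).
Proof.
have [i2|] := leqP 2 i; last by exists 0.
have [ht|] := boolP (0 < t < pi).
  have [E E0 HE] := Ptilde_interior i t i2 ht.
  (* The factor i + 1 pays for sqrt x <= x <= (i + 1)(|L| + 1), where x = 2 L + i - 1 >= 1. *)
  exists (Num.sqrt E * Num.sqrt i.+1%:R) => _ _; split; first by rewrite mulr_ge0 ?sqrtr_ge0.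
  move=> L l lL hl; have h := HE L l lL hl.
  have L0 : 0 <= L by apply: le_trans lL.
  have LE : L%:~R = (absz L)%:R :> R by rewrite -{1}(gez0_abs L0) -pmulrn.
  have x1 : 1 <= 2 * L%:~R + i%:R - 1 :> R.
    have : 2 <= i%:R :> R by rewrite ler_nat.
    have : 0 <= L%:~R :> R by rewrite LE.
    lra.
  set x := 2 * L%:~R + i%:R - 1 in h x1 *.
  have x0 : 0 <= x by apply: le_trans x1.
  have i1 : 1 <= i.+1%:R :> R by rewrite ler1n.
  split.
    rewrite exprMn !sqr_sqrtr//.
    have h1 : Num.sqrt x <= i.+1%:R * (absz L).+1%:R.
      apply: (@le_trans _ _ x).
        rewrite -{2}(sqr_sqrtr x0) expr2 ler_peMl ?sqrtr_ge0//.
        by rewrite -sqrtr1 ler_wsqrtr.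
      rewrite /x LE -[i.+1%:R]natr1 -[(absz L).+1%:R]natr1.
      have : 0 <= (absz L)%:R :> R by []. have : 2 <= i%:R :> R by rewrite ler_nat.
      by move: (i%:R : R) ((absz L)%:R : R) => a b a0 b0; nra.
    have h2 : (absz l).+1%:R ^+ i.-2 <= (absz L).+1%:R ^+ i.-2 :> R.
      by rewrite lerXn2r ?nnegrE// ler_nat; lia.
    have -> : i.-1 = i.-2.+1 by case: (i) i2 => [|[]].
    rewrite [(absz L).+1%:R ^+ _]exprS mulrA; apply: ler_pM => //; rewrite ?sqr_ge0 ?exprn_ge0//.
    by apply: le_trans h _; rewrite -mulrA ler_wpM2l.
  move=> _.
  have x4 : x `^ 4^-1 = Num.sqrt (Num.sqrt x).
    by rewrite -!powR12_sqrt ?powR_ge0// -powRrM -invfM -natrM.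
  rewrite x4 -sqrtr_sqr; apply: (@le_trans _ _ (Num.sqrt (E * Num.sqrt x))).
    exact: ler_wsqrtr.
  rewrite sqrtrM//; apply: ler_wpM2r; first exact: sqrtr_ge0.
  by rewrite ler_peMr ?sqrtr_ge0// -[leLHS]sqrtr1 ler_wsqrtr.
move=> nt; have [tpi|] := boolP (0 <= t <= pi); last first.
  by exists 0.
have tp : t = 0 \/ t = pi.
  move: nt tpi; rewrite negb_and -!leNgt => /orP[h|h] /andP[h1 h2]; [left|right];
    by apply/eqP; rewrite eq_le ?h1 ?h2 ?h.
have [E E0 HE] := Ptilde_pole i t i2 tp.
exists (Num.sqrt E) => _ _; split; first exact: sqrtr_ge0.
move=> L l lL hl; have [h1 h2] := HE L l lL hl; split; last first.
  by move=> lN0; rewrite h1// normr0 mulr_ge0 ?sqrtr_ge0 ?powR_ge0.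
rewrite sqr_sqrtr//; have [->|lN0] := eqVneq l 0.
  by rewrite expr1n mulr1.
by rewrite h1// expr0n mul0r mulr_ge0 ?exprn_ge0.
Qed.

(** For j >= 2, (k + 1)^(j-2) k! <= (k + j - 2)! and k + 1 <= 2k + j - 1; for j = 1 the dimension is
    2. *)
Lemma harm_dim_ge (k j : nat) : (0 < k)%N -> (0 < j)%N ->
  k.+1%:R ^+ j.-1 <= j.-1`!%:R * harm_dim R k j.+1.
Proof.
case: k j => // k [//|j] _ _.
have f0 a : 0 < a`!%:R :> R by rewrite ltr0n fact_gt0.
rewrite /harm_dim subSS subn1 /= mulrA ler_pdivlMr; last by rewrite natrM mulr_gt0.
rewrite -natrX -!natrM ler_nat.
rewrite mulnA [X in (X <= _)%N]mulnC leq_mul2l.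
apply/orP; right.
case: j => [|j].
  rewrite expn0 mul1n factS.
  have -> : (2 * k.+1 + 2 - 2)%N = (2 * k.+1)%N by lia.
  have -> : (k.+1 + 2 - 3)%N = k by lia.
  by rewrite leq_mul// leq_pmull.
have -> : (2 * k.+1 + j.+3 - 2)%N = (2 * k.+1 + j.+1)%N by lia.
have -> : (k.+1 + j.+3 - 3)%N = (k.+1 + j)%N by lia.
rewrite expnS -mulnA leq_mul//; first by lia.
elim: j => [|j IH]; first by rewrite expn0 mul1n addn0.
by rewrite expnS -mulnA addnS factS leq_mul//; lia.
Qed.

End polar_factor_bounds.

(** * Multi-indices and the product of the factors *)

(** Only alpha_1 can be negative, and as a lower index it occurs in the factor i = 2 alone. *)
Lemma tau_adjacent (d k : nat) (alpha : d.-1.-tuple int) (i : nat) :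
  (3 <= d)%N -> tau d k alpha -> (2 <= i < d)%N ->
  `|crd alpha i.-1| <= crd alpha i /\ (0 <= crd alpha i.-1 \/ i = 2%N).
Proof.
move=> d3 [h1 h2 _] /andP[i2 id].
have pos m : (2 <= m < d)%N -> 0 <= crd alpha m.
  elim: m => // m IH /andP[m2 md].
  have [m1|m1] := leqP m 1.
    have -> : m = 1%N by lia.
    exact: le_trans h1.
  apply: le_trans (h2 m _); last by lia.
  by apply: IH; lia.
case: i i2 id => [//|[//|[|i]]] _ id /=; first by split => //; right.
have p := pos i.+2; rewrite ger0_norm; last by apply: p; lia.
by split; [apply: h2; lia|left; apply: p; lia].
Qed.

Lemma tau_neq0 (d k : nat) (alpha : d.-1.-tuple int) (j i : nat) :
  (3 <= d)%N -> tau d k alpha -> (1 <= j)%N -> crd alpha j != 0 ->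
  (j <= i < d)%N -> crd alpha i != 0.
Proof.
move=> d3 ht j1 j0; elim: i => [|i IH] /andP[ji id]; first by lia.
have [->|ji'] := eqVneq i.+1 j; first by [].
have hi : (2 <= i.+1 < d)%N by lia.
have [h _] := tau_adjacent d k alpha i.+1 d3 ht hi.
have : crd alpha i != 0 by apply: IH; lia.
by move: h; rewrite /=; lia.
Qed.

Lemma norm_expi (R : realType) (t : R) : `|expi t| = 1.
Proof. by rewrite normc_def /= cos2Dsin2 sqrtr1. Qed.

Lemma norm_Yharm (R : realType) (d : nat) (alpha : d.-1.-tuple int) (xi : 'rV[R]_d) :
  `|Yharm alpha xi| = ((Num.sqrt (2 * pi))^-1 *
    `|\prod_(2 <= i < d) Ptilde i (crd alpha i) (crd alpha i.-1) (crd (angles xi) i)|)%:C%C.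
Proof.
have normR (x : R) : `|x%:C%C| = `|x|%:C%C.
  by rewrite normc_def /= expr0n addr0 sqrtr_sqr.
rewrite /Yharm !normrM norm_expi mulr1 -rmorph_prod !normR -rmorphM/=.
by rewrite ger0_norm// invr_ge0 sqrtr_ge0.
Qed.

Theorem lemma4p2 (R : realType) (d j : nat) (hd : (3 <= d)%N)
    (hj : (1 <= j <= d - 2)%N) :
  exists D : 'rV[R]_d -> R,
    forall (k : nat) (alpha : d.-1.-tuple int) (xi : 'rV[R]_d),
      (tau d k `\` tau0 d j k) alpha ->
      unit_sphere R d xi ->
      `|Yharm alpha xi| <=
        (D xi * Num.sqrt (harm_dim R `|crd alpha j|%N j.+1) *
         \prod_(j.+1 <= l < d)
           (2 * (crd alpha l)%:~R + l%:R - 1) `^ (4%:R^-1))%:C%C.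
Proof.
have /choice[E HE] : forall it : nat * R, exists E : R, (2 <= it.1)%N -> 0 <= it.2 <= pi ->
  0 <= E /\ forall L l : int, `|l| <= L -> 0 <= l \/ it.1 = 2%N ->
    Ptilde it.1 L l it.2 ^+ 2 * (absz l).+1%:R ^+ it.1.-2 <= E ^+ 2 * (absz L).+1%:R ^+ it.1.-1 /\
    (l != 0 -> `|Ptilde it.1 L l it.2| <= E * (2 * L%:~R + it.1%:R - 1) `^ 4^-1).
  by move=> [i t]; exact: Ptilde_bounds.
(* The root of (j - 1)! is the constant of [harm_dim_ge]. *)
exists (fun xi => (Num.sqrt (2 * pi))^-1 * ((\prod_(2 <= i < j.+1) E (i, crd (angles xi) i)) *
  Num.sqrt (j.-1`!%:R)) * \prod_(j.+1 <= i < d) E (i, crd (angles xi) i)) => k alpha xi [ht hn] hxi.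
have /andP[j1 jd] := hj.
have [_ hth _] : polar_coords xi (angles xi).
  by apply: xgetPex; apply: polar_coords_ex => //; lia.
set th := angles xi in hth *.
pose P i := Ptilde i (crd alpha i) (crd alpha i.-1) (crd th i).
have aj0 : crd alpha j != 0 by apply/eqP => aj; apply: hn.
have HP i (hi : (2 <= i < d)%N) : [/\ 0 <= E (i, crd th i),
    P i ^+ 2 * (absz (crd alpha i.-1)).+1%:R ^+ i.-2 <=
      E (i, crd th i) ^+ 2 * (absz (crd alpha i)).+1%:R ^+ i.-1 &
    crd alpha i.-1 != 0 -> `|P i| <= E (i, crd th i) * (2 * (crd alpha i)%:~R + i%:R - 1) `^ 4^-1].
  have i2 : (2 <= i)%N by case/andP: hi.
  have [h1 h2] := tau_adjacent d k alpha i hd ht hi.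
  have [E0 h] := HE (i, crd th i) i2 (hth i hi).
  by have [h3 h4] := h _ _ h1 h2.
(* The telescoping product; for m = 1 it is empty and the exponent is 0. *)
have prod1 m : (1 <= m < d)%N -> (\prod_(2 <= i < m.+1) P i) ^+ 2 <=
    (\prod_(2 <= i < m.+1) E (i, crd th i)) ^+ 2 * (absz (crd alpha m)).+1%:R ^+ m.-1.
  elim: m => // m IH hm; have [->|m0] := posnP m.
    by rewrite !big_geq// expr1n mul1r expr0.
  rewrite !(big_nat_recr m.+1)/=; [|lia..].
  have hm1 : (2 <= m.+1 < d)%N by lia.
  have [E0 h _] := HP m.+1 hm1; rewrite /= in h.
  have hm' : (1 <= m < d)%N by lia.
  have IH' := IH hm'.
  rewrite !exprMn; move: (\prod_(_ <= i < _) P i) (\prod_(_ <= i < _) E _) IH' => p e IH'.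
  apply: le_trans (ler_wpM2r (sqr_ge0 _) IH') _.
  have -> x y z : x * y * z = x * (z * y) :> R by ring.
  by rewrite -[leRHS]mulrA; apply: ler_wpM2l; first exact: sqr_ge0.
have Epos a b : (2 <= a)%N -> (b <= d)%N -> 0 <= \prod_(a <= i < b) E (i, crd th i).
  move=> ha hb; rewrite big_seq; apply: prodr_ge0 => i; rewrite mem_index_iota => hi.
  have hi' : (2 <= i < d)%N by lia.
  by have [] := HP i hi'.
have jd' : (j.+1 <= d)%N by lia.
rewrite norm_Yharm lecR (big_cat_nat _ (n := j.+1))//=.
rewrite normrM -!mulrA; apply: ler_wpM2l; first by rewrite invr_ge0 sqrtr_ge0.
rewrite !mulrA.
have part1 : `|\prod_(2 <= i < j.+1) P i| <= \prod_(2 <= i < j.+1) E (i, crd th i) *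
    Num.sqrt (j.-1`!%:R) * Num.sqrt (harm_dim R `|crd alpha j|%N j.+1).
  rewrite -mulrA -sqrtrM// -sqrtr_sqr.
  rewrite -[X in _ <= X * _]ger0_norm ?Epos// -sqrtr_sqr -sqrtrM ?sqr_ge0//.
  apply: ler_wsqrtr; apply: le_trans (prod1 j _) _; first by lia.
  by apply: ler_wpM2l; rewrite ?sqr_ge0// harm_dim_ge//; lia.
have part2 : `|\prod_(j.+1 <= i < d) P i| <= \prod_(j.+1 <= i < d) E (i, crd th i) *
    \prod_(j.+1 <= l < d) (2 * (crd alpha l)%:~R + l%:R - 1) `^ (4%:R^-1).
  rewrite -big_split/= normr_prod big_seq [leRHS]big_seq.
  apply: ler_prod => i; rewrite mem_index_iota => hi.
  have hi' : (2 <= i < d)%N by lia.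
  have [_ _ h] := HP i hi'.
  (* For i > j the lower index is alpha_(i-1) with i - 1 >= j, nonzero since alpha_j is. *)
  rewrite normr_ge0 h//; apply: (@tau_neq0 d k alpha j) => //; lia.
apply: le_trans (ler_pM _ _ part1 part2) _; rewrite ?normr_ge0//.
by rewrite le_eqVlt; apply/orP; left; apply/eqP; ring.
Qed.
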